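(* Let $c>0$ be fixed, and let $G$ range over a sequence of digraphs, where $G$ has $n$ vertices and $m\ge cn^2$ edges with $n\to\infty$ along the sequence; let $\overline{G}$ be the underlying undirected graph of $G$. The following are equivalent. \begin{enumerate} \item $\tau(G)=o(m)$. \item $\tau^*(G)=o(m)$. \item $\pi(G)=o(m)$. \item $N(C_4^{\rightarrow},G)=\left(\frac18+o(1)\right)N(C_4,\overline{G})$. \item For every fixed bipartite digraph $B$, $N_L(B,G)=\left(2^{-|E(B)|}+o(1)\right)N_L(\overline{B},\overline{G})$. \item For any even $k\ge 4$, $E_k(G)=\left(\frac12+o(1)\right)N_L(C_k,\overline{G})$. \item For any even $k\ge 4$, $\mathrm{Tr}(A(G)^k)=o\left(\mathrm{Tr}(A(\overline{G})^k)\right)$. \item $|\lambda_1(G)|=o(|\lambda_1(\overline{G})|)$. \item There exists some $\delta=1-o(1)$, $\delta\in(0,1)$, such that $\mathrm{bias}_\delta(G)\le o(m)$. \end{enumerate}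
   Context: All digraphs are finite and oriented: no loops, no parallel edges, no antiparallel edges. The underlying undirected graph $\overline{G}$ is obtained by replacing directed edges by undirected ones; a digraph $B$ is bipartite if $\overline{B}$ is. For a digraph $G=(V,E)$ and $A,B\subset V$, $e(A,B)=|\{(a,b)\in E:a\in A,b\in B\}|$. $\tau(G)=\max_{A,B\subset V}(e(A,B)-e(B,A))$, and $\tau^*(G)=\max_{A,B\subset V,\,A\cap B=\emptyset}(e(A,B)-e(B,A))$. $\beta(G)$ is the minimum size of a set $S\subset E$ such that $(V,E\setminus S)$ has no directed cycles, and $\pi(G)=\frac{m}{2}-\beta(G)$ where $m=|E|$. $N(B,G)$ is the number of (unlabeled, not necessarily induced) copies of $B$ in $G$; $N_L(B,G)$ is the number of labeled copies, i.e. injective maps $V(B)\to V(G)$ taking edges to edges (preserving direction in the digraph case). The same notation is used for undirected graphs. $C_k$ is the undirected cycle on $k$ vertices, and $C_4^{\rightarrow}$ is the orientation of $C_4$ that admits a homomorphism to a single oriented edge (i.e. its vertices alternate between sources and sinks). A $k$-tuple $(v_1,\dots,v_k)$ of vertices of $G$ (with $v_{k+1}:=v_1$) is an even-switch $k$-cycle if for each $i=1,\dots,k$ exactly one of $(v_i,v_{i+1}),(v_{i+1},v_i)$ is in $E$, and $(v_{i+1},v_i)\in E$ for an even number of indices $i$. $E_k(G)$ is the number of even-switch $k$-cycles (as $k$-tuples). The adjacency matrix $A(G)$ of a digraph is indexed by vertices, with $A_{uv}=1$ if $(u,v)\in E$, $A_{uv}=-1$ if $(v,u)\in E$, and $0$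 otherwise; $A(\overline{G})$ is the usual $0/1$ adjacency matrix. $\lambda_1(G)$ and $\lambda_1(\overline{G})$ denote an eigenvalue of largest absolute value of $A(G)$ and $A(\overline{G})$ respectively. For $\delta\in(0,1)$, $\mathrm{bias}_\delta(G)=\max\{e(A,B): A,B\subset V,\ e(B,A)\le\delta\, e(A,B)\}$. *)

(* Defs.v *)
From HB Require Import structures.
From mathcomp Require Import all_boot all_order all_algebra.
From mathcomp Require Import complex.
From mathcomp Require Import all_classical all_reals all_analysis.

Set Implicit Arguments.
Unset Strict Implicit.
Unset Printing Implicit Defensive.

Import Order.TTheory GRing.Theory Num.Theory.
Import numFieldNormedType.Exports.

Local Open Scope ring_scope.

Record digraph := Digraph {
  vertex :> finType;
  edge : rel vertex;
  edge_loopless : forall u, ~~ edge u u;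
  edge_oriented : forall u v, edge u v -> ~~ edge v u
}.

Arguments edge : clear implicits.

(* An undirected graph is represented by its symmetric adjacency relation. *)
Definition underlying (G : digraph) : rel G :=
  fun u v => edge G u v || edge G v u.

Definition bipartite (G : digraph) : Prop :=
  exists side : G -> bool,
    forall u v, underlying u v -> side u != side v.

Definition edges (G : digraph) : {set G * G} := [set p | edge G p.1 p.2].

Definition edges_from_to (G : digraph) (A B : {set G}) : nat :=
  #|[set p in edges G | (p.1 \in A) && (p.2 \in B)]|.

Definition net_edges (G : digraph) (A B : {set G}) : int :=
  (edges_from_to A B)%:Z - (edges_from_to B A)%:Z.

(* The default value 0 in these maxima is the value at A = B = set0. *)
Definition tau (G : digraph) : int :=
  \big[Num.max/0]_(p : {set G} * {set G}) net_edges p.1 p.2.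

Definition tau_star (G : digraph) : int :=
  \big[Num.max/0]_(p : {set G} * {set G} | [disjoint p.1 & p.2])
     net_edges p.1 p.2.

Definition bias (R : realType) (delta : R) (G : digraph) : nat :=
  \max_(p : {set G} * {set G} |
        (edges_from_to p.2 p.1)%:R <= delta * (edges_from_to p.1 p.2)%:R)
     edges_from_to p.1 p.2.

Definition acyclic (T : eqType) (e : rel T) : Prop :=
  forall c : seq T, c != [::] -> ~ ucycle e c.

Definition feedback_set (G : digraph) (S : {set G * G}) : Prop :=
  S \subset edges G /\ acyclic (fun u v => (u, v) \in edges G :\: S).

Lemma feedback_set_edges (G : digraph) : feedback_set (edges G).
Proof.
split=> // -[//|x [|y c]] _; rewrite finset.setDv /ucycle /= !inE //.
Qed.

Definition beta (G : digraph) : nat :=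
  #|[arg min_(S < edges G | `[< feedback_set S >]) #|S| ]|.

Definition half_minus_beta (R : realType) (G : digraph) : R :=
  #|edges G|%:R / 2 - (beta G)%:R.

Section Copies.
Variables (S T : finType) (r : rel S) (e : rel T).

Definition embeddings : {set {ffun S -> T}} :=
  [set f : {ffun S -> T} |
     injectiveb f && [forall x, forall y, r x y ==> e (f x) (f y)]].

Definition labeled_copies : nat := #|embeddings|.

(* The subgraph, as a pair (vertex set, edge set), that an embedding selects.
   For symmetric r and e its edge set is a symmetric set of ordered pairs,
   that is, a set of undirected edges. *)
Definition subgraph_of (f : {ffun S -> T}) : {set T} * {set T * T} :=
  ([set f x | x : S], [set (f p.1, f p.2) | p : S * S & r p.1 p.2]).

Definition copies : nat := #|[set subgraph_of f | f in embeddings]|.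

End Copies.

(* The k-cycle on 'I_k for k >= 3; ordS is the successor modulo k. *)
Definition Cycle (k : nat) : rel 'I_k :=
  fun i j => (j == ordS i) || (i == ordS j).

(* Even vertices are sources and odd vertices are sinks. *)
Definition C4_alternating : rel 'I_4 :=
  fun i j => [&& Cycle i j, ~~ odd i & odd j].

Definition even_switch_cycle (G : digraph) (k : nat) (v : k.-tuple G) : bool :=
  [forall i, edge G (tnth v i) (tnth v (ordS i))
             (+) edge G (tnth v (ordS i)) (tnth v i)]
  && ~~ odd #|[set i | edge G (tnth v (ordS i)) (tnth v i)]|.

Definition even_switch_cycles (k : nat) (G : digraph) : nat :=
  #|[set v : k.-tuple G | even_switch_cycle v]|.

Definition adjmx (R : pzRingType) (G : digraph) : 'M[R]_#|G| :=
  \matrix_(i, j) (if edge G (enum_val i) (enum_val j) then 1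
                  else if edge G (enum_val j) (enum_val i) then -1 else 0).

Definition underlying_adjmx (R : pzRingType) (G : digraph) : 'M[R]_#|G| :=
  \matrix_(i, j) (underlying (enum_val i) (enum_val j))%:R.

Local Open Scope classical_set_scope.

Definition largest_eigenvalue (R : realType) (n : nat) (A : 'M[R[i]]_n)
    (l : R[i]) : Prop :=
  eigenvalue A l /\
  forall l', eigenvalue A l' ->
    Normc.normc l' <= Normc.normc l.

(* Such an eigenvalue exists unless n = 0, in which case the value is 0. *)
Definition lambda1 (R : realType) (n : nat) (A : 'M[R[i]]_n) : R[i] :=
  xget 0 [set l | largest_eigenvalue A l].

Definition is_littleo (R : realType) (f g : nat -> R) : Prop :=
  (f : nat -> R^o) =o_\oo (g : nat -> R^o).

(* f = (a + o(1)) g along the sequence. *)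
Definition asymp_ratio (R : realType) (a : R) (f g : nat -> R) : Prop :=
  exists u : nat -> R, u i @[i --> \oo] --> (0 : R) /\
    \forall i \near \oo, f i = (a + u i) * g i.

(* Main.v *)
Require Import Defs.
From HB Require Import structures.
From mathcomp Require Import all_boot all_order all_algebra.
From mathcomp Require Import complex spectral sesquilinear.
From mathcomp Require Import all_classical all_reals all_analysis.
From mathcomp Require Import ring lra zify.

Set Implicit Arguments.
Unset Strict Implicit.
Unset Printing Implicit Defensive.

Import Order.TTheory GRing.Theory Num.Theory.
Import numFieldNormedType.Exports.

Local Open Scope ring_scope.
(** The nine properties are compared through one quantity, the fourth moment
    [tr (A ^ 4)] of the skew-symmetric matrix [A] of [G].  Since [m] has order
    [n ^ 2], each of them turns out to be equivalent to [tr (A ^ 4) = o(n ^ 4)].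

    - Rectangles.  The sum of [A] over a rectangle is a bilinear form, so two
      applications of the Cauchy-Schwarz inequality bound the fourth power of
      [tau G] by [n ^ 4 tr (A ^ 4)] ([tau_pow4_le]).  The variants of [tau]
      are elementary.  Disjointness of the sides costs a factor 3
      ([tau_le_tau_star]).  A rectangle of large excess gives a vertex order
      with as large a forward excess ([tau_star_le_feedback]), and an order
      cut into boundedly many intervals gives back rectangles
      ([feedback_le_tau]).  A rectangle that violates the constraint defining
      the bias has excess at most [(1 - delta) m] ([tau_le_bias]).

    - Counting.  If [tau G] is small, then replacing an unoriented edge of a
      pattern by an oriented one halves the number of embeddings: with all but
      two vertices fixed, the error is the sum of [A] over a rectangle
      ([pair_sum_le], [orientation_count]).  A bipartite pattern on [s]
      vertices has of order [n ^ s] embeddings in a dense graph, by Jensen's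
      inequality ([bipartite_homs]), so that this additive error is also small
      relative to the count.

    - The 4-cycle.  Let [U] be the adjacency matrix of the underlying graph.
      The expansion of the number of alternating closed 4-walks in [U] and [A]
      shows that sixteen times this number is at least
      [tr (U ^ 4) + tr (A ^ 4)] ([alternating_C4_ge]).  If the proportion of
      alternating 4-cycles is the random one, [tr (A ^ 4)] must be negligible,
      which closes the main circle of implications.

    - Traces and eigenvalues.  The number of even-switch [k]-cycles is
      [(tr (U ^ k) + tr (A ^ k)) / 2] ([tr_even_switch]), and [tr (A ^ k)] is
      bounded by [tr (A ^ 4)] for [k >= 4] ([tr_adjmx_le]).  The matrices [A]
      and [U] are normal, so their fourth moments and their largest eigenvalues
      control each other ([tr_pow4_le_lambda1], [eigenvalue_adjmx_le]). *)

(** * Averaging over finite functions *)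

Section FiniteFunctions.
Variables S T : finType.
Implicit Types (f g h : {ffun S -> T}) (P : pred S).

Definition update f x u : {ffun S -> T} := [ffun z => if z == x then u else f z].

Definition mix P g h : {ffun S -> T} := [ffun z => if P z then g z else h z].

(** The pair (updated function, overwritten value) determines the original
    pair, by the same operation: the reindexing is an involution. *)
Lemma sum_update (V : nmodType) x (F : {ffun S -> T} -> V) :
  \sum_f \sum_u F (update f x u) = (\sum_f F f) *+ #|T|.
Proof.
pose h (p : {ffun S -> T} * T) := (update p.1 x p.2, p.1 x).
have hK : involutive h.
  case=> f u; rewrite /h /= !ffunE eqxx; congr pair.
  by apply/ffunP=> z; rewrite !ffunE; case: eqP => [->|].
rewrite pair_bigA [LHS](reindex_inj (can_inj hK)) /=.
under eq_bigr => p _.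
  have -> : update (h p).1 x (h p).2 = (h (h p)).1 by [].
  rewrite hK.
  over.
rewrite -(pair_bigA _ (fun f _ => F f)) /= -sumrMnl.
by apply: eq_bigr => f _; rewrite sumr_const.
Qed.

(** Here the involution exchanges the values of [g] and [h] outside [P]. *)
Lemma sum_mix (V : nmodType) P (F : {ffun S -> T} -> V) :
  \sum_g \sum_h F (mix P g h) = (\sum_f F f) *+ #|T| ^ #|S|.
Proof.
pose i (p : {ffun S -> T} * {ffun S -> T}) := (mix P p.1 p.2, mix P p.2 p.1).
have iK : involutive i.
  by case=> g h; rewrite /i /=; congr pair; apply/ffunP=> z; rewrite !ffunE; case: (P z).
rewrite pair_bigA [LHS](reindex_inj (can_inj iK)) /=.
under eq_bigr => p _.
  have -> : mix P (i p).1 (i p).2 = (i (i p)).1 by [].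
  rewrite iK.
  over.
rewrite -(pair_bigA _ (fun f _ => F f)) /= -sumrMnl.
by apply: eq_bigr => f _; rewrite sumr_const card_ffun.
Qed.

End FiniteFunctions.

(** * Homomorphisms of bipartite graphs into dense graphs *)

Definition homs (S T : finType) (r : rel S) (e : rel T) : {set {ffun S -> T}} :=
  [set f : {ffun S -> T} | [forall x, forall y, r x y ==> e (f x) (f y)]].

Lemma homsP (S T : finType) (r : rel S) (e : rel T) (f : {ffun S -> T}) :
  reflect (forall x y, r x y -> e (f x) (f y)) (f \in homs r e).
Proof.
rewrite inE; apply: (iffP forallP) => H x; last first.
  by apply/forallP => y; apply/implyP; apply: H.
by move=> y; move/forallP: (H x) => /(_ y)/implyP.
Qed.

(** The power mean inequality, in the division-free form in which it is
    iterated below.  It follows from [0 <= (a - mu) (a ^ s - mu ^ s)]. *)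
Lemma power_mean (R : realDomainType) (I : finType) (a : I -> R) (mu : R) (s : nat) :
    (forall i, 0 <= a i) -> 0 <= mu -> mu *+ #|I| <= \sum_i a i ->
  mu ^+ s *+ #|I| <= \sum_i a i ^+ s.
Proof.
move=> a0 mu0 Hmu; elim: s => [|s IH].
  by under eq_bigr do rewrite expr0; rewrite sumr_const expr0.
have mon b d : 0 <= b -> 0 <= d -> 0 <= (b - d) * (b ^+ s - d ^+ s) :> R.
  move=> b0 d0; case: (leP b d) => bd; last first.
    by rewrite mulr_ge0 // subr_ge0 ?lerXn2r ?(ltW bd) ?nnegrE.
  by rewrite mulr_le0 // subr_le0 ?lerXn2r ?nnegrE.
have : 0 <= \sum_i (a i - mu) * (a i ^+ s - mu ^+ s).
  by apply: sumr_ge0 => i _; apply: mon.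
under eq_bigr => i _.
  have -> : (a i - mu) * (a i ^+ s - mu ^+ s) =
    a i ^+ s.+1 - mu * a i ^+ s - mu ^+ s * a i + mu ^+ s.+1.
    by rewrite !exprS; ring.
  over.
rewrite big_split /= !sumrB -!mulr_sumr sumr_const => H.
have := ler_wpM2l (exprn_ge0 s mu0) Hmu; have := ler_wpM2l mu0 IH.
rewrite -(mulr_natr mu) -(mulr_natr (mu ^+ s)).
rewrite -(mulr_natr (mu ^+ s.+1)) exprS in H *.
move: (\sum_i a i) (\sum_i a i ^+ s) (\sum_i a i ^+ s.+1) (mu ^+ s) #|I|%:R H.
by move=> x y z w N; lra.
Qed.

Lemma natr_forall (R : comPzSemiRingType) (I : finType) (P : pred I) :
  [forall i, P i]%:R = \prod_i (P i)%:R :> R.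
Proof.
case: forallP => [H|/forallP/forallPn[i /negbTE Hi]].
  by rewrite big1 // => i _; rewrite H.
by rewrite (bigD1 i) //= Hi mul0r.
Qed.

Section BipartiteCount.
Variables (R : realDomainType) (S T : finType) (c : R) (e : rel T).
Hypotheses (c0 : 0 <= c) (e_sym : symmetric e).
Hypothesis dense : c * #|T|%:R ^+ 2 <= \sum_u \sum_v (e u v)%:R.

Let n : R := #|T|%:R.

(** Jensen's inequality twice: for the degrees, which counts stars, and for
    the common degrees of families of [#|S|] vertices. *)
Lemma complete_bipartite_count :
  c ^+ (#|S| * #|S|) * n ^+ (2 * #|S|) <=
  \sum_(g : {ffun S -> T}) \sum_(h : {ffun S -> T})
     [forall x, forall y, e (g x) (h y)]%:R.
Proof.
have n0 : 0 <= n by rewrite ler0n.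
have stars : (c * n) ^+ #|S| *+ #|T| <=
    \sum_v (\sum_u (e u v)%:R) ^+ #|S|.
  apply: power_mean; first by move=> v; apply: sumr_ge0 => u _; rewrite ler0n.
    by rewrite mulr_ge0.
  by rewrite exchange_big /= -mulr_natr -mulrA -expr2.
pose a (g : {ffun S -> T}) : R := \sum_v \prod_x (e (g x) v)%:R.
have sum_a : \sum_g a g = \sum_v (\sum_u (e u v)%:R) ^+ #|S|.
  rewrite /a exchange_big /=; apply: eq_bigr => v _.
  rewrite -(bigA_distr_bigA (fun (_ : S) u => (e u v)%:R : R)).
  by rewrite prodr_const.
have a0 g : 0 <= a g.
  by apply: sumr_ge0 => v _; apply: prodr_ge0 => x _; rewrite ler0n.
have := @power_mean R {ffun S -> T} a (c ^+ #|S| * n) #|S| a0 _ _.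
rewrite mulr_ge0 ?exprn_ge0 // => /(_ isT).
rewrite sum_a (le_trans _ stars); last first.
  rewrite card_ffun -[X in X <= _]mulr_natr -[X in _ <= X]mulr_natr natrX exprMn.
  by rewrite mulrAC.
move=> /(_ isT); rewrite card_ffun -mulr_natr natrX -/n => H.
apply: (le_trans _ (le_trans H _)).
  by rewrite exprMn -exprM mul2n -addnn exprD mulrA.
apply: ler_sum => g _.
rewrite /a -prodr_const bigA_distr_bigA /=.
apply: ler_sum => h _.
under eq_bigr => y _ do rewrite -natr_forall.
rewrite -natr_forall ler_nat.
case: forallP => // H1; case: forallP => // -[] x; apply/forallP => y.
by have /forallP := H1 y.
Qed.

(** Colouring the vertices of [r] by its two sides turns a pair of maps from
    [S] into one map, and the homomorphisms of the complete bipartite graph on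
    two copies of [S] into homomorphisms of [r]. *)
Lemma bipartite_homs (r : rel S) (side : S -> bool) :
    (forall x y, r x y -> side x != side y) -> (0 < #|T|)%N ->
  c ^+ (#|S| * #|S|) * n ^+ #|S| <= #|homs r e|%:R.
Proof.
move=> sideP T0.
have nS : 0 < n ^+ #|S| by rewrite exprn_gt0 // ltr0n.
rewrite -(ler_pM2r nS) -mulrA -exprD addnn -mul2n.
apply: (le_trans complete_bipartite_count).
have -> : #|homs r e|%:R * n ^+ #|S| =
    \sum_g \sum_h (mix side g h \in homs r e)%:R :> R.
  rewrite (sum_mix side (fun f => (f \in homs r e)%:R)) -natrX mulr_natr.
  rewrite -sum1_card natr_sum [in LHS]big_mkcond; congr (_ *+ _).
  by apply: eq_bigr => f _; case: ifP.
apply: ler_sum => g _; apply: ler_sum => h _; rewrite ler_nat.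
case: forallP => // H; rewrite lt0b; apply/homsP => x y /sideP.
rewrite !ffunE; have := H x; have := H y.
move=> /forallP/(_ x) Hy /forallP/(_ y) Hx.
by case: (side x); case: (side y) => // _; rewrite e_sym.
Qed.

End BipartiteCount.

(** * Non-injective maps are rare *)

Section Noninjective.
Variables S T : finType.

(** If [f x = f y] with [x != y], then all but one of the ways to overwrite
    [f x] destroy the coincidence; this saves a factor [#|T|] for each of the
    at most [#|S| ^ 2] pairs. *)
Lemma card_noninjective :
  (#|[set f : {ffun S -> T} | ~~ injectiveb f]| * #|T| <=
   #|S| ^ 2 * #|T| ^ #|S|)%N.
Proof.
pose F (p : S * S) := [set f : {ffun S -> T} | (p.1 != p.2) && (f p.1 == f p.2)].
have cardF p : (#|F p| * #|T| <= #|T| ^ #|S|)%N.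
  have -> : (#|F p| * #|T|)%N = (\sum_f (f \in F p)%:R) *+ #|T| :> nat.
    rewrite -mulr_natr natn; congr muln; rewrite -sum1_card big_mkcond.
    by apply: eq_bigr => f _; case: ifP.
  rewrite -(sum_update p.1) -card_ffun -sum1_card.
  apply: leq_sum => f _.
  case: (eqVneq p.1 p.2) => [E|ne].
    by rewrite big1 // => u _; rewrite inE E eqxx.
  rewrite (bigD1 (f p.2)) //= [X in (_ + X)%R]big1 ?addr0; first by case: (_ \in _).
  move=> u /negbTE Hu; rewrite inE !ffunE eqxx [p.2 == _]eq_sym.
  by rewrite (negbTE ne) Hu.
apply: (@leq_trans ((\sum_p #|F p|) * #|T|)).
  rewrite leq_mul2r; apply/orP; right.
  have sub : [set f : {ffun S -> T} | ~~ injectiveb f] \subset \bigcup_p F p.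
    apply/fintype.subsetP => f; rewrite inE => /injectivePn[x [y ne E]].
    by apply/bigcupP; exists (x, y) => //; rewrite inE ne E eqxx.
  apply: (leq_trans (subset_leq_card sub)).
  elim/big_ind2: _ => [|m A k B Am Bk|//]; first by rewrite cards0.
  apply: (leq_trans (leq_card_setU A B).1); exact: leq_add.
apply: (@leq_trans (\sum_(p : S * S) #|T| ^ #|S|)).
  by rewrite big_distrl; apply: leq_sum => p _; apply: cardF.
by rewrite sum_nat_const card_prod expnS expn1.
Qed.

Lemma card_embeddings (r : rel S) (e : rel T) :
  (#|homs r e| <= labeled_copies r e +
     #|[set f : {ffun S -> T} | ~~ injectiveb f]|)%N.
Proof.
apply: leq_trans (leq_card_setU _ _).1; apply: subset_leq_card.
by apply/fintype.subsetP => f; rewrite !inE => ->; rewrite andbT orbN.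
Qed.

Lemma embeddings_sub_homs (r : rel S) (e : rel T) :
  (labeled_copies r e <= #|homs r e|)%N.
Proof.
by apply: subset_leq_card; apply/fintype.subsetP => f; rewrite !inE => /andP[].
Qed.

End Noninjective.

(** * The signed edge function and its sums over rectangles *)

Definition sgn (R : pzRingType) (G : digraph) (u v : G) : R :=
  (edge G u v)%:R - (edge G v u)%:R.

Definition und (R : pzRingType) (G : digraph) (u v : G) : R :=
  (underlying u v)%:R.

Section SignedEdges.
Variables (R : numDomainType) (G : digraph).
Implicit Types (u v : G) (A B : {set G}).

Lemma edge_asym u v : edge G u v -> edge G v u = false.
Proof. by move/edge_oriented/negbTE. Qed.

Lemma edge_irrefl u : edge G u u = false.
Proof. exact/negbTE/edge_loopless. Qed.

Lemma underlying_sym : symmetric (@underlying G).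
Proof. by move=> u v; rewrite /underlying orbC. Qed.

Lemma sgn_antisym u v : sgn R v u = - sgn R u v.
Proof. by rewrite /sgn opprB. Qed.

Lemma sgnE u v :
  sgn R u v = if edge G u v then 1 else if edge G v u then -1 else 0.
Proof.
rewrite /sgn; case E: (edge G u v); first by rewrite (edge_asym E) mulr0n subr0.
by case: (edge G v u); rewrite /= ?mulr0n ?sub0r ?oppr0.
Qed.

Lemma und_sgn u v : und R u v + sgn R u v = 2 * (edge G u v)%:R.
Proof.
rewrite /und /sgn /underlying; case E: (edge G u v) => /=.
  by rewrite (edge_asym E) mulr0n subr0 mulr1.
by case: (edge G v u); rewrite /= ?mulr0n ?mulr0 ?sub0r ?oppr0 ?addr0 ?subrr.
Qed.

Lemma norm_sgn u v : `|sgn R u v| = und R u v.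
Proof.
rewrite /und /sgn /underlying; case E: (edge G u v) => /=.
  by rewrite (edge_asym E) mulr0n subr0 normr1.
by case: (edge G v u); rewrite /= ?mulr0n ?sub0r ?normrN ?normr1 ?normr0.
Qed.

Lemma card_edges_cond (P : rel G) :
  #|[set p in edges G | P p.1 p.2]| = (\sum_u \sum_v (edge G u v && P u v))%N.
Proof.
rewrite -sum1_card big_mkcond pair_bigA /=; apply: eq_bigr => -[u v] _.
by rewrite !inE; case: ifP.
Qed.

Lemma net_edgesE A B :
  (net_edges A B)%:~R = \sum_(u in A) \sum_(v in B) sgn R u v.
Proof.
rewrite /net_edges intrB -!pmulrn.
have e_sum C D : (edges_from_to C D)%:R =
    \sum_(u in C) \sum_(v in D) (edge G u v)%:R :> R.
  rewrite /edges_from_to (card_edges_cond (fun u v => (u \in C) && (v \in D))).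
  rewrite natr_sum [RHS]big_mkcond; apply: eq_bigr => u _.
  rewrite natr_sum; case: ifP => uC; last first.
    by rewrite big1 // => v _; rewrite andbF.
  by rewrite [RHS]big_mkcond; apply: eq_bigr => v _; case: ifP; rewrite ?andbT ?andbF.
rewrite !e_sum [X in _ - X]exchange_big /= -sumrB; apply: eq_bigr => u _.
by rewrite -sumrB.
Qed.

Lemma net_edges_anti A B : net_edges B A = - net_edges A B.
Proof. by rewrite /net_edges opprB. Qed.

Lemma le_tau A B : net_edges A B <= tau G.
Proof. exact: (le_bigmax 0 (fun p => net_edges p.1 p.2) (A, B)). Qed.

Lemma tau_ge0 : 0 <= tau G.
Proof. by apply: le_trans (le_tau finset.set0 finset.set0); rewrite /net_edges subrr. Qed.

Lemma tau_le x : 0 <= x -> (forall A B, net_edges A B <= x) -> tau G <= x.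
Proof. by move=> x0 H; apply: bigmax_le => // -[A B] _; apply: H. Qed.

Lemma le_tau_star A B : [disjoint A & B] -> net_edges A B <= tau_star G.
Proof.
exact: (le_bigmax_cond 0 (fun p => net_edges p.1 p.2) (j := (A, B))
  (P := fun p => [disjoint p.1 & p.2])).
Qed.

Lemma tau_star_ge0 : 0 <= tau_star G.
Proof.
have /le_tau_star : [disjoint (finset.set0 : {set G}) & (finset.set0 : {set G})].
  by rewrite -finset.setI_eq0 finset.set0I.
by rewrite /net_edges subrr.
Qed.

Lemma tau_star_le_tau : tau_star G <= tau G.
Proof. by apply: bigmax_le => [|p _]; [exact: tau_ge0|exact: le_tau]. Qed.

Lemma norm_rectangle_le A B :
  `|\sum_(u in A) \sum_(v in B) sgn R u v| <= (tau G)%:~R.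
Proof.
rewrite -net_edgesE -intr_norm ler_int ler_norml le_tau andbT.
by rewrite lerNl -net_edges_anti le_tau.
Qed.

(** A rectangle [A x B] splits along [A :&: B] into three rectangles with
    disjoint sides and the square of [A :&: B], whose edges cancel. *)
Lemma tau_le_tau_star : tau G <= 3 * tau_star G.
Proof.
apply: tau_le => [|A B]; first by rewrite mulr_ge0 // tau_star_ge0.
pose C := A :&: B.
have splitl D A1 : net_edges A1 D = net_edges (A1 :\: C) D + net_edges (A1 :&: C) D.
  apply: (@intr_inj R); rewrite [RHS]intrD !net_edgesE (big_setID C) /= addrC.
  by [].
have splitr D A1 : net_edges D A1 = net_edges D (A1 :\: C) + net_edges D (A1 :&: C).
  rewrite -[LHS]opprK -net_edges_anti (splitl D A1) opprD.
  by rewrite -!(net_edges_anti _ D).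
have CC : net_edges C C = 0 by rewrite /net_edges subrr.
have AC : A :&: C = C by rewrite /C finset.setIA finset.setIid.
have BC : B :&: C = C by rewrite /C [A :&: B]finset.setIC finset.setIA finset.setIid.
rewrite (splitl B A) (splitr (A :\: C) B) AC BC (splitr C B) BC CC addr0.
have d1 : net_edges (A :\: C) (B :\: C) <= tau_star G.
  apply: le_tau_star; rewrite -finset.setI_eq0; apply/eqP/setP => x.
  by rewrite !inE; case: (x \in A); case: (x \in B).
have d2 : net_edges (A :\: C) C <= tau_star G.
  apply: le_tau_star; rewrite -finset.setI_eq0; apply/eqP/setP => x.
  by rewrite !inE; case: (x \in A); case: (x \in B).
have d3 : net_edges C (B :\: C) <= tau_star G.
  apply: le_tau_star; rewrite -finset.setI_eq0; apply/eqP/setP => x.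
  by rewrite !inE; case: (x \in A); case: (x \in B).
lra.
Qed.

End SignedEdges.

(** * Feedback edge sets and vertex orders *)

(** In an acyclic relation the set of vertices reachable from a vertex
    shrinks strictly along every edge; ties in its size are broken by the
    enumeration of the vertices. *)
Lemma topological_order (T : finType) (e : rel T) : acyclic e ->
  exists p : T -> nat, [/\ injective p, forall x, (p x < #|T|)%N &
    forall x y, e x y -> (p y < p x)%N].
Proof.
move=> acy; pose r x := #|[set y | connect e x y]|.
have r_lt x y : e x y -> (r y < r x)%N.
  move=> exy; apply: proper_card; apply/properP; split.
    apply/fintype.subsetP => z; rewrite !inE; apply: connect_trans.
    exact: connect1.
  exists x; rewrite !inE ?connect0 //; apply/connectP => -[p ep xE].
  case: (shortenP ep) xE => p' ep' up' _ xE.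
  apply: (acy (y :: p')) => //; rewrite /ucycle /= rcons_path ep' -xE exy.
  exact: up'.
pose k x := (r x * #|T| + enum_rank x)%N.
have k_inj : injective k.
  move=> x y kE; apply: enum_rank_inj; apply: val_inj => /=.
  have T0 : (0 < #|T|)%N by apply: leq_ltn_trans (ltn_ord (enum_rank x)).
  by have := congr1 (modn^~ #|T|) kE; rewrite !modnMDl !modn_small.
have k_lt x y : e x y -> (k y < k x)%N.
  move=> /r_lt rxy; have := ltn_ord (enum_rank y); rewrite /k => H.
  apply: (@leq_trans ((r y).+1 * #|T|)).
    by rewrite mulSn addnC ltn_add2r.
  by apply: leq_trans (leq_addr _ _); rewrite leq_mul2r rxy orbT.
pose p x := #|[set y | (k y < k x)%N]|.
have p_lt x y : (k y < k x)%N -> (p y < p x)%N.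
  move=> kyx; apply: proper_card; apply/properP; split.
    by apply/fintype.subsetP => z; rewrite !inE => /ltn_trans; apply.
  by exists y; rewrite !inE ?ltnn.
exists p; split.
- move=> x y pE; apply: k_inj; case: (ltngtP (k x) (k y)) => // /p_lt;
  by rewrite pE ltnn.
- move=> x; rewrite -cardsT; apply: proper_card; apply/properP; split.
    exact: finset.subsetT.
  by exists x; rewrite !inE ?ltnn.
- by move=> x y /k_lt/p_lt.
Qed.

Section Feedback.
Variables (R : realType) (G : digraph).
Local Notation n := #|G|.

Definition backward_edges (p : G -> nat) : {set G * G} :=
  [set q in edges G | (p q.2 < p q.1)%N].

Lemma feedback_backward (p : G -> nat) :
  injective p -> feedback_set (backward_edges p).
Proof.
move=> p_inj; split; first by apply/fintype.subsetP => q; rewrite inE => /andP[].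
move=> [//|x0 c] _ /andP[cyc _].
have [x xc xmax] := @arg_maxnP _ x0 (fun x => x \in x0 :: c) p (mem_head _ _).
have := next_cycle cyc xc; have := mem_next (x0 :: c) x; rewrite xc.
move: (next (x0 :: c) x) => y /xmax /= yx; rewrite !inE /=.
case exy: (edge G x y); rewrite !(andbT, andbF) // => /negP; apply.
rewrite ltn_neqAle yx andbT; apply: contraTneq exy => /p_inj ->.
by rewrite edge_irrefl.
Qed.

Lemma beta_le (S : {set G * G}) : feedback_set S -> (beta G <= #|S|)%N.
Proof.
move=> fS; rewrite /beta; case: arg_minnP => [|T _]; last by apply; apply/asboolP.
exact/asboolP/feedback_set_edges.
Qed.

Lemma betaP : exists2 S : {set G * G}, feedback_set S & #|S| = beta G.
Proof.
rewrite /beta; case: arg_minnP; first exact/asboolP/feedback_set_edges.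
by move=> S /asboolP fS _; exists S.
Qed.

Lemma card_edges : #|edges G| = (\sum_u \sum_v edge G u v)%N.
Proof.
have -> : edges G = [set q in edges G | true].
  by apply/setP => q; rewrite !inE andbT.
rewrite (card_edges_cond (fun _ _ => true)); apply: eq_bigr => u _.
by apply: eq_bigr => v _; rewrite andbT.
Qed.

(** Two vertex orders are averaged: both put [A] just before [B], the other
    vertices come last in one and first in the other, and inside each of
    the three classes the two orders are opposite.  An edge from [A] to [B]
    is backward in none of them, an edge from [B] to [A] in both, and every
    other edge in exactly one. *)
Lemma tau_star_le_feedback : (tau_star G)%:~R <= 2 * half_minus_beta R G.
Proof.
rewrite /half_minus_beta.
suff : tau_star G <= #|edges G|%:Z - 2 * (beta G)%:Z.
  rewrite -(ler_int R) intrB intrM -!pmulrn.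
  by lra.
have key (A B : {set G}) : [disjoint A & B] ->
    net_edges A B <= #|edges G|%:Z - 2 * (beta G)%:Z.
  move=> dAB.
  pose c1 u := if u \in A then 0%N else if u \in B then 1%N else 2.
  pose c2 u := if u \in A then 1%N else if u \in B then 2 else 0%N.
  pose p1 u := (c1 u * n + enum_rank u)%N.
  pose p2 u := (c2 u * n + rev_ord (enum_rank u))%N.
  have n0 (u : G) : (0 < n)%N by apply: leq_ltn_trans (ltn_ord (enum_rank u)).
  have p1_inj : injective p1.
    move=> u v pE; apply: enum_rank_inj; apply: val_inj => /=.
    have := congr1 (modn^~ n) pE.
    by rewrite !modnMDl !modn_small.
  have p2_inj : injective p2.
    move=> u v pE; apply: enum_rank_inj; apply: rev_ord_inj; apply: val_inj.
    have := congr1 (modn^~ n) pE.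
    by rewrite !modnMDl !modn_small.
  have count u v : edge G u v ->
    ((p1 v < p1 u) + (p2 v < p2 u) + ((u \in A) && (v \in B)) =
     1 + ((u \in B) && (v \in A)))%N.
    move=> euv.
    have neq : enum_rank u != enum_rank v :> nat.
      rewrite val_eqE (inj_eq enum_rank_inj); apply: contraTneq euv => ->.
      by rewrite edge_irrefl.
    have dis w : ~~ ((w \in A) && (w \in B)).
      by move: dAB; rewrite -finset.setI_eq0 => /eqP/setP/(_ w); rewrite !inE => ->.
    have := dis u; have := dis v.
    rewrite /p1 /p2 /c1 /c2 /=.
    have := ltn_ord (enum_rank u); have := ltn_ord (enum_rank v).
    move: neq; move: (nat_of_ord (enum_rank u)) (nat_of_ord (enum_rank v)) => a b.
    move: #|G| => N.
    case: (u \in A); case: (u \in B) => //; case: (v \in A); case: (v \in B) => //=;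
    by move=> neq bN aN _ _; do 2 case: ltnP => ?; lia.
  have sum_count : (#|backward_edges p1| + #|backward_edges p2| +
      edges_from_to A B = #|edges G| + edges_from_to B A)%N.
    rewrite /backward_edges /edges_from_to card_edges.
    rewrite (card_edges_cond (fun u v => p1 v < p1 u)%N).
    rewrite (card_edges_cond (fun u v => p2 v < p2 u)%N).
    rewrite (card_edges_cond (fun u v => (u \in A) && (v \in B))).
    rewrite (card_edges_cond (fun u v => (u \in B) && (v \in A))).
    rewrite -!big_split; apply: eq_bigr => u _ /=.
    rewrite -!big_split; apply: eq_bigr => v _ /=.
    by case euv: (edge G u v) => //=; apply: count.
  have := beta_le (feedback_backward p1_inj).
  have := beta_le (feedback_backward p2_inj).
  rewrite /net_edges; move: sum_count.
  by lia.
apply: bigmax_le => [|[A B] /key //].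
have /key : [disjoint (finset.set0 : {set G}) & (finset.set0 : {set G})].
  by rewrite -finset.setI_eq0 finset.set0I.
by rewrite /net_edges subrr.
Qed.

(** An optimal order is cut into intervals of [L] vertices.  Edges inside an
    interval are few, and the forward excess between an interval and all the
    earlier ones is a sum over one rectangle. *)
Lemma feedback_le_tau (L : nat) : (0 < L)%N ->
  2 * half_minus_beta R G <=
  n%:R * L%:R + ((n %/ L).+1)%:R * (tau G)%:~R.
Proof.
move=> L0; have [S [SE acy] cS] := betaP.
have [p [p_inj p_lt p_dec]] := topological_order acy.
have step1 : 2 * half_minus_beta R G <=
    \sum_u \sum_(v | (p v < p u)%N) sgn R u v.
  pose F := [set q in edges G | (p q.2 < p q.1)%N].
  pose B := [set q in edges G | (p q.1 < p q.2)%N].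
  have FS : (#|edges G| - #|S| <= #|F|)%N.
    rewrite -(finset.setIidPr SE) -cardsD; apply: subset_leq_card.
    apply/fintype.subsetP => -[u v] H; rewrite /F !inE /= in H *.
    by have/andP[_ ->] := H; rewrite p_dec // !inE.
  have BS : (#|B| <= #|S|)%N.
    apply: subset_leq_card; apply/fintype.subsetP => -[u v]; rewrite !inE /=.
    move=> /andP[euv lt]; apply/negPn/negP => nS.
    have : (p v < p u)%N by apply: p_dec; rewrite !inE nS.
    by move=> /(ltn_trans lt); rewrite ltnn.
  have SmE := subset_leq_card SE.
  have : 2 * half_minus_beta R G <= #|F|%:R - #|B|%:R.
    rewrite /half_minus_beta -cS.
    have : #|edges G|%:R <= #|F|%:R + #|S|%:R :> R by rewrite -natrD ler_nat; lia.
    have : #|B|%:R <= #|S|%:R :> R by rewrite ler_nat.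
    lra.
  move=> /le_trans; apply.
  rewrite /F /B (card_edges_cond (fun u v => p v < p u)%N).
  rewrite (card_edges_cond (fun u v => p u < p v)%N).
  rewrite [X in _ - X%:R]exchange_big !natr_sum -sumrB.
  rewrite le_eqVlt; apply/orP; left; apply/eqP/eq_bigr => u _.
  rewrite !natr_sum -sumrB [RHS]big_mkcond.
  by apply: eq_bigr => v _; case: (p v < p u)%N; rewrite ?andbT ?andbF ?subrr.
apply: (le_trans step1).
pose b u := (p u %/ L)%N.
have b_le u v : (p u <= p v)%N -> (b u <= b v)%N by apply: leq_div2r.
have split_b u : \sum_(v | (p v < p u)%N) sgn R u v =
   \sum_(v | (p v < p u)%N && (b v == b u)) sgn R u v +
   \sum_(v | (b v < b u)%N) sgn R u v.
  rewrite (bigID (fun v => b v == b u)) /=; congr (_ + _); apply: eq_bigl => v.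
  case: (ltnP (p v) (p u)) => [/ltnW/b_le le|/b_le ge].
    by rewrite ltn_neqAle le andbT.
  by rewrite ltnNge ge.
under eq_bigr => u _ do rewrite split_b.
rewrite big_split /=; apply: lerD.
  rewrite -natrM -sum_nat_const natr_sum; apply: ler_sum => u _.
  apply: (@le_trans _ _ (#|[set v | b v == b u]|%:R)).
    rewrite -sum1_card natr_sum big_mkcond [X in _ <= X]big_mkcond.
    apply: ler_sum => v _; rewrite inE; case: (b v == b u); rewrite ?andbF ?andbT //.
    case: ifP => // _; apply: le_trans (ler_norm _) _.
    by rewrite norm_sgn /und; case: (underlying u v).
  rewrite ler_nat -[X in (_ <= X)%N]card_ord.
  pose q (v : G) : 'I_L := Ordinal (ltn_pmod (p v) L0).
  rewrite -(card_in_imset (f := q)); first exact: max_card.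
  move=> v w; rewrite !inE => /eqP bv /eqP bw [qE].
  by apply: p_inj; rewrite (divn_eq (p v) L) (divn_eq (p w) L) qE -!/(b _) bv bw.
pose K := (n %/ L)%N.
have bK u : (b u < K.+1)%N by rewrite ltnS leq_div2r // ltnW.
rewrite (partition_big (fun u => Ordinal (bK u)) predT) //=.
apply: (@le_trans _ _ (\sum_(j < K.+1) (tau G)%:~R)); last first.
  by rewrite sumr_const card_ord mulr_natl.
apply: ler_sum => j _.
apply: le_trans (norm_rectangle_le R [set u | b u == j] [set v | (b v < j)%N]).
apply: le_trans (ler_norm _); rewrite le_eqVlt; apply/orP; left; apply/eqP.
rewrite big_mkcond [RHS]big_mkcond; apply: eq_bigr => u _.
rewrite inE -val_eqE /=; case: eqP => // ->; apply: eq_bigl => v.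
by rewrite inE.
Qed.

End Feedback.

(** * Bias *)

Section Bias.
Variables (R : realType) (G : digraph) (delta : R).

Lemma bias_le_tau : (bias delta G)%:R * (1 - delta) <= (tau G)%:~R.
Proof.
pose P (p : {set G} * {set G}) := (edges_from_to p.2 p.1)%:R <=
  delta * (edges_from_to p.1 p.2)%:R.
have P0 : (0 < #|P|)%N.
  apply/card_gt0P; exists (finset.set0, finset.set0).
  rewrite unfold_in /P /=.
  suff -> : edges_from_to (finset.set0 : {set G}) finset.set0 = 0%N.
    by rewrite mulr0.
  by apply: eq_card0 => q; rewrite !inE /= andbF.
have [[A B]] := eq_bigmax_cond (fun p => edges_from_to p.1 p.2) P0.
rewrite unfold_in /P /= => bAB E; rewrite /bias E.
have := le_tau A B; rewrite -(ler_int R) /net_edges intrB -!pmulrn.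
by lra.
Qed.

Lemma tau_attained : exists A B : {set G}, tau G = net_edges A B.
Proof.
rewrite /tau; elim/big_ind: _ => [|x y [A [B xE]] [C [D yE]]|[A B] _].
- by exists finset.set0, finset.set0; rewrite /net_edges subrr.
- by case: (leP x y) => _; [exists C, D|exists A, B].
- by exists A, B.
Qed.

(** A rectangle attaining [tau G] either satisfies the constraint in the
    definition of the bias, or is nearly balanced, with an excess of at most
    [(1 - delta) m]. *)
Lemma tau_le_bias : 0 <= delta <= 1 ->
  (tau G)%:~R <= (bias delta G)%:R + (1 - delta) * #|edges G|%:R.
Proof.
move=> /andP[d0 d1].
have m0 : 0 <= (1 - delta) * #|edges G|%:R by rewrite mulr_ge0 // subr_ge0.
have [A [B ->]] := tau_attained.
rewrite /net_edges intrB -!pmulrn.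
have e_le : (edges_from_to A B)%:R <= #|edges G|%:R :> R.
  rewrite ler_nat; apply: subset_leq_card; apply/fintype.subsetP => q.
  by rewrite inE => /andP[].
have [bAB|bAB] := leP ((edges_from_to B A)%:R : R) (delta * (edges_from_to A B)%:R).
  have : (edges_from_to A B)%:R <= (bias delta G)%:R :> R.
    rewrite ler_nat.
    exact: (@leq_bigmax_cond _ (fun p => (edges_from_to p.2 p.1)%:R <=
      delta * (edges_from_to p.1 p.2)%:R) (fun p => edges_from_to p.1 p.2) (A, B)).
  by have : 0 <= (edges_from_to B A)%:R :> R by []; lra.
have : 0 <= (bias delta G)%:R :> R by [].
have := ler_wpM2l (_ : 0 <= 1 - delta) e_le; rewrite subr_ge0 => /(_ d1).
lra.
Qed.

End Bias.


(** * Counting embeddings by rectangle sums *)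

Section Counting.
Variables (R : realDomainType) (S : finType) (G : digraph).
Local Notation n := (#|G|%:R : R).

Definition all_pairs (cond : S -> S -> rel G) (f : {ffun S -> G}) : bool :=
  [forall a, forall b, cond a b (f a) (f b)].

Lemma all_pairsP (cond : S -> S -> rel G) (f : {ffun S -> G}) :
  reflect (forall a b, cond a b (f a) (f b)) (all_pairs cond f).
Proof.
apply: (iffP forallP) => H a; last by apply/forallP.
by move=> b; move/forallP: (H a).
Qed.

(** If no condition binds the values at [x] and [y] together, then, the values
    at all other points being fixed, the conditions confine the values at [x]
    and at [y] to two independent sets, and the sum runs over a rectangle. *)
Lemma pair_sum_le (x y : S) (cond : S -> S -> rel G) : x != y ->
    (forall u v, cond x y u v) -> (forall u v, cond y x u v) ->
  `|\sum_(f : {ffun S -> G}) sgn R (f x) (f y) * (all_pairs cond f)%:R| * n ^+ 2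
    <= (tau G)%:~R * n ^+ #|S|.
Proof.
move=> ne cxy cyx.
set F := (F in \sum_f F f).
have -> : `|\sum_f F f| * n ^+ 2 =
    `|\sum_f \sum_v \sum_u F (update (update f y v) x u)|.
  rewrite (sum_update y (fun f => \sum_u F (update f x u))) sum_update.
  rewrite -mulrnA -[in RHS]mulr_natr normrM natrM -expr2.
  by rewrite [`|_ ^+ 2|]ger0_norm ?sqr_ge0.
apply: (le_trans (ler_norm_sum _ _ _)).
rewrite -natrX -card_ffun mulr_natr -sumr_const; apply: ler_sum => f _.
pose g u := [forall a, forall b, [|| a == y, b == y |
  cond a b (update f x u a) (update f x u b)]].
pose h v := [forall a, forall b, [|| a == x, b == x |
  cond a b (update f y v a) (update f y v b)]].
have split_cond u v : all_pairs cond (update (update f y v) x u) = g u && h v.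
  apply/all_pairsP/andP => [H|[/forallP Hg /forallP Hh] a b].
    split; apply/forallP => a; apply/forallP => b; have := H a b.
      rewrite !ffunE; case: (eqVneq a y) => //= ay; case: (eqVneq b y) => //= _.
    by rewrite !ffunE; case: (eqVneq a x) => //= ax; case: (eqVneq b x).
  move: (Hg a) => /forallP/(_ b); move: (Hh a) => /forallP/(_ b).
  rewrite !ffunE.
  have [->|ax] := eqVneq a x; have [->|bx] := eqVneq b x => //=;
    rewrite ?(negbTE ne) ?orbF //=.
  - by have [->|_] := eqVneq b y.
  - by have [->|_] := eqVneq a y.
rewrite exchange_big /=.
apply: le_trans (norm_rectangle_le R [set u | g u] [set v | h v]).
rewrite le_eqVlt; apply/orP; left; apply/eqP; congr `|_|.
rewrite [RHS]big_mkcond; apply: eq_bigr => u _; rewrite inE.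
rewrite [in RHS]big_mkcond; case: ifP => gu; last first.
  by rewrite big1 // => v _; rewrite /F split_cond gu mulr0.
apply: eq_bigr => v _; rewrite inE /F split_cond gu !ffunE eqxx.
rewrite [y == x]eq_sym (negbTE ne) eqxx /=.
by case: ifP; rewrite ?mulr1 ?mulr0.
Qed.

End Counting.

Section Hybrids.
Variables (R : realDomainType) (B G : digraph).
Local Notation n := (#|G|%:R : R).
Local Notation s := #|B|.

(** Hybrids interpolate between embeddings of the underlying graphs and
    embeddings of [B] in [G]: orientations are respected on [J] only.
    Injectivity is included as one more condition on pairs of vertices, so
    that [pair_sum_le] applies. *)
Definition hybrid_cond (J : {set B * B}) (a b : B) : rel G := fun u v =>
  ((a != b) ==> (u != v)) &&
  (edge B a b ==> if (a, b) \in J then edge G u v else underlying u v).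

Definition hybrid (J : {set B * B}) : R :=
  2 ^+ #|J| * \sum_(f : {ffun B -> G}) (all_pairs (hybrid_cond J) f)%:R.

Lemma sum_indicator (I : finType) (P : pred I) :
  \sum_i (P i)%:R = #|[set i | P i]|%:R :> R.
Proof.
rewrite -sum1_card natr_sum [RHS]big_mkcond; apply: eq_bigr => i _.
by rewrite inE; case: ifP.
Qed.

Lemma hybrid0 : hybrid finset.set0 =
  (labeled_copies (@underlying B) (@underlying G))%:R.
Proof.
rewrite /hybrid cards0 expr0 mul1r sum_indicator; congr (_%:R).
apply: eq_card => f; rewrite !inE; apply/all_pairsP/andP => [H|[/injectiveP inj]].
  split.
    apply/injectiveP => a b fE; apply/eqP/negPn/negP => ab.
    by have := H a b; rewrite /hybrid_cond ab fE eqxx.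
  apply/forallP => a; apply/forallP => b; apply/implyP => /orP[] ab.
    by have /andP[_] := H a b; rewrite ab inE.
  by rewrite underlying_sym; have /andP[_] := H b a; rewrite ab inE.
move=> /forallP H a b; apply/andP; split.
  by apply/implyP; apply: contraNneq => /inj ->.
apply/implyP => ab; rewrite inE; move/forallP: (H a) => /(_ b)/implyP; apply.
by rewrite /underlying ab.
Qed.

Lemma hybrid_edges : hybrid (edges B) =
  2 ^+ #|edges B| * (labeled_copies (edge B) (edge G))%:R.
Proof.
rewrite /hybrid sum_indicator; congr (_ * _%:R).
apply: eq_card => f; rewrite !inE; apply/all_pairsP/andP => [H|[/injectiveP inj]].
  split.
    apply/injectiveP => a b fE; apply/eqP/negPn/negP => ab.
    by have := H a b; rewrite /hybrid_cond ab fE eqxx.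
  apply/forallP => a; apply/forallP => b; apply/implyP => ab.
  by have /andP[_] := H a b; rewrite inE ab.
move=> /forallP H a b; apply/andP; split.
  by apply/implyP; apply: contraNneq => /inj ->.
apply/implyP => ab; rewrite inE ab; move/forallP: (H a) => /(_ b)/implyP; exact.
Qed.

(** The difference of the two hybrids carries the factor
    [2 [u -> v] - [u ~ v] = sgn u v] at the pair [p].  As [B] is oriented,
    no other condition binds the two ends of [p], apart from injectivity,
    which [sgn] implies. *)
Lemma hybrid_step (J : {set B * B}) (p : B * B) :
    p \in edges B -> p \notin J ->
  `|hybrid (p |: J) - hybrid J| * n ^+ 2 <= 2 ^+ #|J| * ((tau G)%:~R * n ^+ s).
Proof.
case: p => x y; rewrite inE /= => exy nJ.
have ne : x != y by apply: contraTneq exy => ->; rewrite edge_irrefl.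
pose cond a b : rel G := fun u v =>
  [|| (a, b) == (x, y), (a, b) == (y, x) | hybrid_cond J a b u v].
have -> : hybrid ((x, y) |: J) - hybrid J =
    2 ^+ #|J| * \sum_(f : {ffun B -> G})
       sgn R (f x) (f y) * (all_pairs cond f)%:R.
  have E f (K : {set B * B}) (w : rel G) :
      (forall u v, hybrid_cond K x y u v = (u != v) && w u v) ->
      (forall u v, w u v -> u != v) ->
      (forall a b, (a, b) != (x, y) -> hybrid_cond K a b =2 hybrid_cond J a b) ->
    all_pairs (hybrid_cond K) f = w (f x) (f y) && all_pairs cond f.
    move=> Kxy wne KJ; apply/all_pairsP/andP => [H|[wxy /all_pairsP H] a b].
      split; first by have := H x y; rewrite Kxy => /andP[].
      apply/all_pairsP => a b; rewrite /cond.
      by case: (eqVneq (a, b) (x, y)) => //= nab; rewrite -KJ // H orbT.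
    case: (eqVneq (a, b) (x, y)) => [[-> ->]|nab]; first by rewrite Kxy wne.
    rewrite KJ //; have := H a b; rewrite /cond (negbTE nab) /=.
    case: (eqVneq (a, b) (y, x)) => [[-> ->] _|//].
    by rewrite /hybrid_cond eq_sym ne (edge_asym exy) eq_sym wne.
  rewrite /hybrid cardsU1 nJ exprSr -mulrA -mulrBr mulr_sumr -sumrB.
  congr (_ * _); apply: eq_bigr => f _.
  have E1 : all_pairs (hybrid_cond J) f = underlying (f x) (f y) && all_pairs cond f.
    apply: E => [u v|u v|//]; first by rewrite /hybrid_cond ne exy (negbTE nJ).
    by apply: contraTneq => ->; rewrite /underlying edge_irrefl.
  have E2 : all_pairs (hybrid_cond ((x, y) |: J)) f =
      edge G (f x) (f y) && all_pairs cond f.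
    apply: E => [u v|u v|a b nab u v].
    - by rewrite /hybrid_cond ne exy !inE eqxx.
    - by apply: contraTneq => ->; rewrite edge_irrefl.
    - by rewrite /hybrid_cond !inE (negbTE nab).
  rewrite E1 E2; case: (all_pairs cond f); rewrite ?andbF ?andbT ?mulr1 ?mulr0 ?subrr //.
  by rewrite -und_sgn /und addrAC subrr add0r.
rewrite normrM ger0_norm ?exprn_ge0 // -mulrA ler_wpM2l ?exprn_ge0 //.
by apply: pair_sum_le => // u v; rewrite /cond eqxx ?orbT.
Qed.

(** All orientations of [B] are asymptotically equally likely: passing from
    an unoriented edge to an oriented one halves the count up to an error
    controlled by [tau G]. *)
Lemma orientation_count :
  `|2 ^+ #|edges B| * (labeled_copies (edge B) (edge G))%:R -
    (labeled_copies (@underlying B) (@underlying G))%:R| * n ^+ 2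
  <= 2 ^+ #|edges B| * ((tau G)%:~R * n ^+ s).
Proof.
have D0 : 0 <= (tau G)%:~R * n ^+ s by rewrite mulr_ge0 ?exprn_ge0 // ler0z tau_ge0.
suff H k (J : {set B * B}) : J \subset edges B -> #|J| = k ->
    `|hybrid J - hybrid finset.set0| * n ^+ 2 <= (2 ^+ k - 1) * ((tau G)%:~R * n ^+ s).
  rewrite -hybrid_edges -hybrid0; apply: le_trans (H _ _ (subxx _) erefl) _.
  by rewrite ler_wpM2r // gerBl.
elim: k J => [|k IH] J JE cJ.
  by rewrite (cards0_eq cJ) subrr normr0 mul0r expr0 subrr mul0r.
have [p pJ] : exists p, p \in J by apply/card_gt0P; rewrite cJ.
have cJ' : #|J :\ p| = k by move: cJ; rewrite (cardsD1 p) pJ => -[].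
have J'E : J :\ p \subset edges B by apply: fintype.subset_trans JE; apply: subD1set.
have := IH _ J'E cJ'.
have := @hybrid_step (J :\ p) p (fintype.subsetP JE _ pJ).
rewrite !inE eqxx => /(_ isT); rewrite cJ' finset.setD1K // => H1 H2.
have := ler_wpM2r (sqr_ge0 n)
  (ler_distD (hybrid (J :\ p)) (hybrid J) (hybrid finset.set0)).
move=> /le_trans; apply; rewrite mulrDl; apply: le_trans (lerD H1 H2) _.
by rewrite -mulrDl exprS ler_wpM2r //; lra.
Qed.

End Hybrids.

(** * Labeled and unlabeled copies *)

Section Automorphisms.
Variables (S T : finType) (r : rel S) (e : rel T).

Definition automorphisms : {set {ffun S -> S}} :=
  [set s : {ffun S -> S} |
     injectiveb s && [forall x, forall y, r (s x) (s y) == r x y]].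

Lemma automorphismsP (s : {ffun S -> S}) :
  reflect (injective s /\ forall x y, r (s x) (s y) = r x y)
          (s \in automorphisms).
Proof.
rewrite inE; apply: (iffP andP) => -[/injectiveP inj H]; split => //.
  by move=> x y; move/forallP: H => /(_ x)/forallP/(_ y)/eqP.
by apply/forallP => x; apply/forallP => y; rewrite H.
Qed.

Lemma embeddingsP (f : {ffun S -> T}) :
  reflect (injective f /\ forall x y, r x y -> e (f x) (f y))
          (f \in embeddings r e).
Proof.
rewrite inE; apply: (iffP andP) => -[/injectiveP inj H]; split => //.
  by move=> x y; move/forallP: H => /(_ x)/forallP/(_ y)/implyP.
by apply/forallP => x; apply/forallP => y; apply/implyP; apply: H.
Qed.

Lemma subgraph_edge (f : {ffun S -> T}) x y : injective f ->
  ((f x, f y) \in (subgraph_of r f).2) = r x y.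
Proof.
move=> inj; apply/imsetP/idP => [[[a b]]|rxy]; last by exists (x, y); rewrite ?inE.
by rewrite inE /= => rab [/inj -> /inj ->].
Qed.

(** Two embeddings select the same subgraph iff they differ by an
    automorphism of the pattern. *)
Lemma subgraph_fiber (f : {ffun S -> T}) : f \in embeddings r e ->
  [set g in embeddings r e | subgraph_of r g == subgraph_of r f] =
  [set [ffun x => f (s x)] | s : {ffun S -> S} in automorphisms].
Proof.
move=> /embeddingsP[f_inj f_hom]; apply/setP => g; rewrite inE.
apply/andP/imsetP => [[/embeddingsP[g_inj g_hom] /eqP gf]|].
  pose s : {ffun S -> S} := [ffun x => odflt x [pick y | f y == g x]].
  have fs x : f (s x) = g x.
    rewrite ffunE; case: pickP => [y /eqP //|no].
    have : g x \in (subgraph_of r f).1 by rewrite -gf; apply/imsetP; exists x.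
    by case/imsetP => y _ E; have := no y; rewrite E eqxx.
  exists s; last by apply/ffunP => x; rewrite ffunE fs.
  apply/automorphismsP; split => [x y sE|x y].
    by apply: g_inj; rewrite -!fs sE.
  by rewrite -(subgraph_edge _ _ f_inj) !fs -gf subgraph_edge.
move=> [s /automorphismsP[s_inj s_aut] ->].
have [t ts st] := injF_bij s_inj.
split.
  apply/embeddingsP; split => [x y|x y rxy]; rewrite !ffunE.
    by move=> /f_inj/s_inj.
  by apply: f_hom; rewrite s_aut.
apply/eqP; congr pair; apply/setP => z; apply/imsetP/imsetP.
- by move=> [x _ ->]; exists (s x); rewrite ?ffunE.
- by move=> [x _ ->]; exists (t x); rewrite ?ffunE ?st.
- move=> [[x y]]; rewrite inE /= => rxy ->; exists (s x, s y).
    by rewrite inE /= s_aut.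
  by rewrite !ffunE.
- move=> [[x y]]; rewrite inE /= => rxy ->; exists (t x, t y).
    by rewrite inE /= -s_aut !st.
  by rewrite !ffunE !st.
Qed.

Lemma labeled_copiesE : labeled_copies r e = (#|automorphisms| * copies r e)%N.
Proof.
rewrite /labeled_copies -sum1_card (partition_big_imset (subgraph_of r)) /=.
rewrite mulnC /copies -sum_nat_const; apply: eq_bigr => z /imsetP[f fE ->].
have -> : #|automorphisms| =
    #|[set [ffun x => f (s x)] | s : {ffun S -> S} in automorphisms]|.
  rewrite card_imset // => s t /ffunP H; apply/ffunP => x.
  by have := H x; rewrite !ffunE; case/embeddingsP: fE => inj _ /inj.
rewrite -subgraph_fiber // -sum1_card; apply: eq_bigl => g.
by rewrite !inE.
Qed.

End Automorphisms.

Section FourCycle.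

Lemma Cycle4_odd (i j : 'I_4) : Cycle i j -> odd j = ~~ odd i.
Proof.
by case: i => -[|[|[|[|//]]]] ?; case: j => -[|[|[|[|//]]]] ?; rewrite /Cycle -!val_eqE.
Qed.

Lemma odd_ordS4 (i : 'I_4) : odd (ordS i) = ~~ odd i.
Proof. by case: i => -[|[|[|[|//]]]] ?. Qed.

Lemma Cycle_ordS (k : nat) (i j : 'I_k) : Cycle (ordS i) (ordS j) = Cycle i j.
Proof. by rewrite /Cycle !(inj_eq (@ordS_inj k)). Qed.

Lemma C4_underlying (i j : 'I_4) :
  C4_alternating i j || C4_alternating j i = Cycle i j.
Proof.
rewrite /C4_alternating [Cycle j i]orbC -/(Cycle i j).
case E: (Cycle i j) => //=; rewrite (Cycle4_odd E).
by case: (odd i).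
Qed.

(** An automorphism of the 4-cycle preserves or exchanges the two classes of
    the bipartition, and the rotation exchanges these two kinds. *)
Lemma card_automorphisms_C4 :
  #|automorphisms (@Cycle 4)| = (2 * #|automorphisms C4_alternating|)%N.
Proof.
pose A b := [set s in automorphisms (@Cycle 4) | odd (s ord0) == b].
pose rot (s : {ffun 'I_4 -> 'I_4}) : {ffun 'I_4 -> 'I_4} := [ffun i => ordS (s i)].
have rot_inj : injective rot.
  move=> s t /ffunP H; apply/ffunP => i; have := H i; rewrite !ffunE.
  exact: ordS_inj.
have rotA b : (#|A b| <= #|A (~~ b)|)%N.
  rewrite -(card_imset _ rot_inj); apply: subset_leq_card.
  apply/fintype.subsetP => t /imsetP[s sA {t}->].
  move: sA; rewrite !inE -andbA => /and3P[].
  move=> /injectiveP inj /forallP H /eqP <-; rewrite !ffunE odd_ordS4 eqxx andbT.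
  apply/andP; split.
    by apply/injectiveP => i j; rewrite !ffunE => /ordS_inj/inj.
  apply/forallP => i; apply/forallP => j; rewrite !ffunE Cycle_ordS.
  by move/forallP: (H i).
have -> : automorphisms C4_alternating = A false.
  apply/setP => s; rewrite [RHS]inE.
  apply/automorphismsP/andP => [[inj H]|[/automorphismsP[inj H] even0]].
    split.
      by apply/automorphismsP; split => // i j; rewrite -!C4_underlying !H.
    have := H ord0 (ordS ord0); rewrite {2}/C4_alternating {1}/Cycle eqxx /=.
    by case/and3P => _ /negbTE ->.
  split => // i j; rewrite /C4_alternating H.
  have step k : odd (s (ordS k)) = ~~ odd (s k).
    by apply: Cycle4_odd; rewrite H /Cycle eqxx.
  have par k : odd (s k) = odd k.
    have P0 : odd (s ord0) = odd (ord0 : 'I_4) by apply/eqP.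
    have P1 := step ord0; have P2 := step (ordS ord0).
    have P3 := step (ordS (ordS ord0)).
    have kE : k \in [:: ord0; ordS ord0; ordS (ordS ord0); ordS (ordS (ordS ord0))].
      by case: k => -[|[|[|[|//]]]] ?; rewrite !inE -!val_eqE.
    move: kE; rewrite !inE => /or4P[] /eqP ->; rewrite ?odd_ordS4 //.
    - by rewrite P1 P0.
    - by rewrite P2 P1 P0.
    - by rewrite P3 P2 P1 P0 ?odd_ordS4.
  by rewrite !par.
rewrite -sum1_card (bigID (fun s : {ffun 'I_4 -> 'I_4} => odd (s ord0))) /= mul2n -addnn.
have cA b : \sum_(s in automorphisms (@Cycle 4) | odd (s ord0) == b) 1%N = #|A b|.
  by rewrite -sum1_card; apply: eq_bigl => s; rewrite [RHS]inE.
congr addn.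
  transitivity #|A true|; first by rewrite -cA; apply: eq_bigl => s; case: (odd _).
  by apply/eqP; rewrite eqn_leq (rotA true) (rotA false).
by rewrite -cA; apply: eq_bigl => s; case: (odd _).
Qed.

(** Passing from copies to labeled copies turns the ratio 1/8 into 1/16. *)
Lemma copies_C4 (T : finType) (e e' : rel T) : exists2 a : nat, (0 < a)%N &
  labeled_copies C4_alternating e = (a * copies C4_alternating e)%N /\
  labeled_copies (@Cycle 4) e' = (2 * a * copies (@Cycle 4) e')%N.
Proof.
exists #|automorphisms C4_alternating|.
  apply/card_gt0P; exists [ffun i => i]; apply/automorphismsP.
  by split=> [i j|i j]; rewrite !ffunE.
by rewrite -card_automorphisms_C4 !labeled_copiesE.
Qed.

End FourCycle.

(** * Traces of matrix products as sums over closed walks *)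

Section ClosedWalks.
Variables (R : comPzRingType) (n : nat).
Implicit Types (w : nat -> 'M[R]_n) (x y : 'I_n).

(** The product of the entries along the walk [x, t, y], the first step being
    taken with the matrix [w m]. *)
Fixpoint walk_weight w m x (t : seq 'I_n) y : R :=
  if t is z :: t' then w m x z * walk_weight w m.+1 z t' y else w m x y.

Lemma sum_tuple_cons (V : nmodType) (T : finType) k (F : k.+1.-tuple T -> V) :
  \sum_s F s = \sum_x \sum_(t : k.-tuple T) F [tuple of x :: t].
Proof.
rewrite pair_bigA /= (reindex (fun p : T * k.-tuple T => [tuple of p.1 :: p.2])) //=.
exists (fun s : k.+1.-tuple T => (thead s, [tuple of behead s])) => [[x t] _|s _] /=.
  by congr pair; apply: val_inj.
by rewrite -tuple_eta.
Qed.

Lemma prod_mx_walks w k m x y :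
  (\prod_(m <= i < m + k.+1) w i) x y = \sum_(t : k.-tuple 'I_n) walk_weight w m x t y.
Proof.
elim: k m x => [|k IH] m x.
  by rewrite addn1 big_nat1 (big_pred1 [tuple]) // => t; exact/esym/eqP/tuple0.
rewrite -addSnnS big_ltn ?leq_addr // -mulmxE mxE sum_tuple_cons.
apply: eq_bigr => z _; rewrite IH mulr_sumr.
by apply: eq_bigr => t _.
Qed.

Lemma walk_weightE x0 w m x t y : walk_weight w m x t y =
  \prod_(i < (size t).+1) w (m + i)%N (nth x0 (x :: t) i) (nth x0 (rcons t y) i).
Proof.
elim: t m x => [|z t IH] m x /=; first by rewrite big_ord1 addn0.
rewrite big_ord_recl addn0 /= IH; congr (_ * _).
by apply: eq_bigr => i _; rewrite /bump /= add1n addSnnS.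
Qed.

Lemma tr_prod_tuples w k : \tr (\prod_(i < k.+1) w i) =
  \sum_(s : k.+1.-tuple 'I_n) \prod_(i < k.+1) w i (tnth s i) (tnth s (ordS i)).
Proof.
rewrite /mxtrace -(big_mkord xpredT w) sum_tuple_cons; apply: eq_bigr => x _.
rewrite (prod_mx_walks w k 0); apply: eq_bigr => t _.
rewrite (walk_weightE x) size_tuple; apply: eq_bigr => i _; rewrite add0n.
rewrite !(tnth_nth x) /=; congr (w _ _ _).
rewrite nth_rcons size_tuple; have := ltn_ord i; rewrite ltnS.
case: ltngtP => // [ik|ik] _; first by rewrite modn_small.
by rewrite ik modnn.
Qed.

End ClosedWalks.

Section ClosedWalksGraph.
Variables (R : comPzRingType) (T : finType).

Lemma sum_tuple_enum_val (V : nmodType) k (F : k.-tuple T -> V) :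
  \sum_(s : k.-tuple 'I_#|T|) F [tuple of map enum_val s] = \sum_s F s.
Proof.
rewrite [RHS](reindex (fun s : k.-tuple 'I_#|T| => [tuple of map enum_val s])) //.
exists (fun s : k.-tuple T => [tuple of map enum_rank s]) => s _;
  apply: val_inj => /=; rewrite -map_comp -[RHS]map_id; apply: eq_map => x /=.
  by rewrite enum_valK.
by rewrite enum_rankK.
Qed.

Lemma sum_tuple_ffun (V : nmodType) k (F : {ffun 'I_k -> T} -> V) :
  \sum_(s : k.-tuple T) F [ffun i => tnth s i] = \sum_f F f.
Proof.
rewrite [RHS](reindex (fun s : k.-tuple T => [ffun i => tnth s i])) //.
exists (fun f : {ffun 'I_k -> T} => [tuple f i | i < k]) => [s _|f _].
  by apply: eq_from_tnth => i; rewrite tnth_mktuple ffunE.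
by apply/ffunP => i; rewrite ffunE tnth_mktuple.
Qed.

Definition mx_of (a : T -> T -> R) : 'M[R]_#|T| :=
  \matrix_(i, j) a (enum_val i) (enum_val j).

(** The matrices are allowed to depend on the step, as in an alternating
    closed walk. *)
Lemma tr_closed_walks (a : nat -> T -> T -> R) k : (0 < k)%N ->
  \tr (\prod_(i < k) mx_of (a i)) =
  \sum_(s : k.-tuple T) \prod_(i < k) a i (tnth s i) (tnth s (ordS i)).
Proof.
case: k => // k _; rewrite (tr_prod_tuples (fun i => mx_of (a i))).
rewrite -sum_tuple_enum_val; apply: eq_bigr => s _; apply: eq_bigr => i _.
by rewrite mxE !tnth_map.
Qed.

End ClosedWalksGraph.

Section AdjacencyTraces.
Variables (R : realDomainType) (G : digraph).
Local Notation A := (adjmx R G).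
Local Notation U := (underlying_adjmx R G).

Lemma adjmxE : A = mx_of (@sgn R G).
Proof. by apply/matrixP => i j; rewrite !mxE sgnE. Qed.

Lemma underlying_adjmxE : U = mx_of (@und R G).
Proof. by apply/matrixP => i j; rewrite !mxE. Qed.

Lemma tr_adjmx k : (0 < k)%N -> \tr (A ^+ k) =
  \sum_(s : k.-tuple G) \prod_(i < k) sgn R (tnth s i) (tnth s (ordS i)).
Proof.
move=> k0; rewrite -(tr_closed_walks (fun _ => @sgn R G) k0) prodr_const card_ord.
by rewrite adjmxE.
Qed.

Lemma tr_underlying_adjmx k : (0 < k)%N -> \tr (U ^+ k) =
  \sum_(s : k.-tuple G) \prod_(i < k) und R (tnth s i) (tnth s (ordS i)).
Proof.
move=> k0; rewrite -(tr_closed_walks (fun _ => @und R G) k0) prodr_const card_ord.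
by rewrite underlying_adjmxE.
Qed.

(** The sign of a closed walk is that of its number of backward edges. *)
Lemma tr_even_switch k : (0 < k)%N ->
  \tr (A ^+ k) + \tr (U ^+ k) = 2 * (even_switch_cycles k G)%:R.
Proof.
move=> k0; rewrite tr_adjmx // tr_underlying_adjmx // -big_split /=.
rewrite /even_switch_cycles -sum_indicator mulr_sumr; apply: eq_bigr => s _.
pose e i := edge G (tnth s i) (tnth s (ordS i)).
pose b i := edge G (tnth s (ordS i)) (tnth s i).
have uE i : und R (tnth s i) (tnth s (ordS i)) = (e i (+) b i)%:R.
  rewrite /und /underlying -/(e i) -/(b i).
  by case E: (e i) => //=; rewrite /b (edge_asym E).
have sE i : sgn R (tnth s i) (tnth s (ordS i)) = (-1) ^+ b i * (e i (+) b i)%:R.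
  rewrite /sgn -/(e i) -/(b i); case E: (e i).
    by rewrite /b (edge_asym E) subr0 mul1r.
  by case: (b i); rewrite /= ?expr0 ?expr1 ?mulr0n ?sub0r ?mulr1 ?mulr0 ?oppr0.
under eq_bigr do rewrite sE.
under [X in _ + X]eq_bigr do rewrite uE.
rewrite big_split /= -(natr_forall R (fun i => e i (+) b i)) prodrXr.

have -> : even_switch_cycle s =
  [forall i, e i (+) b i] && ~~ odd #|[set i | b i]| by [].
have -> : (\sum_i b i = #|[set i | b i]|)%N.
  rewrite -sum1_card [RHS]big_mkcond; apply: eq_bigr => i _; rewrite inE.
  by case: (b i).
rewrite -signr_odd; case: [forall i, e i (+) b i]; last by rewrite /= !mulr0 addr0.
by case: (odd _); rewrite /= ?expr1 ?expr0 ?mulr0 ?mulr1 ?addNr.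
Qed.

Lemma tr_homs_cycle k : (0 < k)%N ->
  \tr (U ^+ k) = #|homs (@Cycle k) (@underlying G)|%:R.
Proof.
move=> k0; rewrite tr_underlying_adjmx //.
rewrite -[homs _ _](_ : [set f | f \in homs (@Cycle k) (@underlying G)] = _); last first.
  by apply/setP => f; rewrite inE.
rewrite -sum_indicator -sum_tuple_ffun; apply: eq_bigr => s _.
rewrite -(natr_forall R (fun i => underlying (tnth s i) (tnth s (ordS i)))).
congr (_%:R); congr nat_of_bool; apply/forallP/homsP => [H i j|H i].
  by rewrite !ffunE => /orP[] /eqP ->; rewrite // underlying_sym.
by have := H i (ordS i); rewrite !ffunE /Cycle eqxx; apply.
Qed.

End AdjacencyTraces.

(** * The Frobenius norm *)

Section Frobenius.
Variable R : realDomainType.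

Lemma cauchy_schwarz (I : finType) (a b : I -> R) :
  (\sum_i a i * b i) ^+ 2 <= (\sum_i a i ^+ 2) * (\sum_i b i ^+ 2).
Proof.
have : 0 <= \sum_i \sum_j (a i * b j - a j * b i) ^+ 2.
  by apply: sumr_ge0 => i _; apply: sumr_ge0 => j _; apply: sqr_ge0.
have -> : \sum_i \sum_j (a i * b j - a j * b i) ^+ 2 =
  2 * ((\sum_i a i ^+ 2) * (\sum_i b i ^+ 2)) - 2 * (\sum_i a i * b i) ^+ 2.
  transitivity (\sum_i \sum_j (a i ^+ 2 * b j ^+ 2 + b i ^+ 2 * a j ^+ 2 -
      2 * (a i * b i * (a j * b j)))).
    by apply: eq_bigr => i _; apply: eq_bigr => j _; ring.
  under eq_bigr do rewrite sumrB big_split /= -!mulr_sumr.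
  rewrite sumrB big_split /= -!mulr_suml -mulr_sumr -mulr_suml expr2.
  ring.
lra.
Qed.

(** Squared, since [R] need not contain square roots. *)
Definition frob2 m n (M : 'M[R]_(m, n)) : R := \sum_i \sum_j M i j ^+ 2.

Lemma frob2_ge0 m n (M : 'M[R]_(m, n)) : 0 <= frob2 M.
Proof. by apply: sumr_ge0 => i _; apply: sumr_ge0 => j _; apply: sqr_ge0. Qed.

Lemma frob2_tr m n (M : 'M[R]_(m, n)) : frob2 M^T = frob2 M.
Proof.
rewrite /frob2 exchange_big; apply: eq_bigr => i _; apply: eq_bigr => j _.
by rewrite mxE.
Qed.

Lemma frob2N m n (M : 'M[R]_(m, n)) : frob2 (- M) = frob2 M.
Proof. by apply: eq_bigr => i _; apply: eq_bigr => j _; rewrite mxE sqrrN. Qed.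

Lemma frob2_scalar (M : 'M[R]_1) : frob2 M = M 0 0 ^+ 2.
Proof. by rewrite /frob2 !big_ord1. Qed.

Lemma tr_mul_trmx m n (M : 'M[R]_(m, n)) : \tr (M *m M^T) = frob2 M.
Proof.
by apply: eq_bigr => i _; rewrite mxE; apply: eq_bigr => j _; rewrite mxE expr2.
Qed.

Lemma frob2_mul m n p (M : 'M[R]_(m, n)) (N : 'M[R]_(n, p)) :
  frob2 (M *m N) <= frob2 M * frob2 N.
Proof.
rewrite /frob2 mulr_suml; apply: ler_sum => i _.
rewrite [X in _ * X]exchange_big mulr_sumr; apply: ler_sum => j _.
by rewrite mxE; apply: cauchy_schwarz.
Qed.

Lemma frob2_exp n (M : 'M[R]_n) k : frob2 (M ^+ k.+1) <= frob2 M ^+ k.+1.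
Proof.
elim: k => [|k IH]; first by rewrite !expr1.
rewrite exprS [X in _ <= X]exprS; apply: le_trans (frob2_mul _ _) _.
by rewrite ler_wpM2l ?frob2_ge0.
Qed.

Lemma tr_mul_le m n (M : 'M[R]_(m, n)) (N : 'M[R]_(n, m)) :
  \tr (M *m N) ^+ 2 <= frob2 M * frob2 N.
Proof.
rewrite -(frob2_tr N) /frob2 !pair_bigA /=.
have -> : \tr (M *m N) = \sum_(p : 'I_m * 'I_n) M p.1 p.2 * N^T p.1 p.2.
  rewrite -(pair_bigA _ (fun i j => M i j * N^T i j)) /=.
  by apply: eq_bigr => i _; rewrite mxE; apply: eq_bigr => j _; rewrite mxE.
exact: cauchy_schwarz.
Qed.

End Frobenius.

(** * The fourth moment of the signed adjacency matrix *)

Section FourthMoment.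
Variables (R : realDomainType) (G : digraph).
Local Notation A := (adjmx R G).
Local Notation U := (underlying_adjmx R G).
Local Notation n := (#|G|%:R : R).

Lemma trmx_adjmx : A^T = - A.
Proof. by rewrite adjmxE; apply/matrixP => i j; rewrite !mxE sgn_antisym. Qed.

Lemma trmx_underlying_adjmx : U^T = U.
Proof. by apply/matrixP => i j; rewrite !mxE underlying_sym. Qed.

Lemma frob2_adjmx : frob2 A <= n ^+ 2.
Proof.
rewrite expr2 -natrM; apply: (@le_trans _ _ (\sum_(i < #|G|) \sum_(j < #|G|) 1)).
  apply: ler_sum => i _; apply: ler_sum => j _; rewrite adjmxE mxE sgnE.
  by do 2?case: ifP => _; rewrite ?sqrrN ?expr1n ?expr0n.
by rewrite !sumr_const card_ord -mulrnA.
Qed.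

Lemma frob2_adjmx_sqr : frob2 (A ^+ 2) = \tr (A ^+ 4).
Proof.
rewrite -tr_mul_trmx expr2 trmx_mul trmx_adjmx !mulmxE mulrNN.
by rewrite -!expr2 -exprM.
Qed.

(** With [P = U ^ 2 - A ^ 2] and [Q = A U - U A], both symmetric, the product
    [(U + A)(U - A)] is [P + Q].  The trace of [P Q] vanishes by cyclicity,
    that of [Q ^ 2] is a squared norm, and that of [P ^ 2] exceeds
    [tr (U ^ 4) + tr (A ^ 4)] by [- 2 tr (U ^ 2 A ^ 2)], twice the squared
    norm of [U A]. *)
Lemma alternating_C4_ge :
  \tr (U ^+ 4) + \tr (A ^+ 4) <= \tr (((U + A) * (U - A)) ^+ 2).
Proof.
have tA := trmx_adjmx; have tU := trmx_underlying_adjmx.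
pose P := U ^+ 2 - A ^+ 2; pose Q := A * U - U * A.
have -> : (U + A) * (U - A) = P + Q.
  rewrite mulrDl !mulrBr [A * U - _]addrC addrACA [_ + A * U]addrC.
  by rewrite -!expr2.
have tQ : Q^T = Q.
  rewrite /Q linearB /= -!mulmxE !trmx_mul tA tU !mulmxE.
  by rewrite mulrN mulNr opprK addrC.
have trQ : 0 <= \tr (Q ^+ 2) by rewrite expr2 -{2}tQ -mulmxE tr_mul_trmx frob2_ge0.
have trU : \tr (U ^+ 2 * A ^+ 2) <= 0.
  have -> : \tr (U ^+ 2 * A ^+ 2) = - \tr ((U * A) *m (U * A)^T).
    rewrite -mulmxE trmx_mul tA tU !mulmxE.
    rewrite !mulNr mulrN linearN /= opprK mulrA.
    by rewrite -mulmxE [in RHS]mxtrace_mulC mulmxE !expr2 !mulrA.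
  by rewrite oppr_le0 tr_mul_trmx frob2_ge0.
have trC (X Y : 'M[R]_#|G|) : \tr (X * Y) = \tr (Y * X) by exact: mxtrace_mulC.
have trPQ : \tr (P * Q) = 0.
  rewrite /P /Q mulrBr !mulrBl !linearB /= !expr2.
  have -> : \tr (U * U * (A * U)) = \tr (U * U * (U * A)).
    by rewrite mulrA trC !mulrA.
  have -> : \tr (A * A * (U * A)) = \tr (A * A * (A * U)).
    by rewrite mulrA trC !mulrA.
  by rewrite subrr.
have trPP : \tr (P ^+ 2) = \tr (U ^+ 4) + \tr (A ^+ 4) - 2 * \tr (U ^+ 2 * A ^+ 2).
  rewrite expr2 /P mulrBr !mulrBl !linearB /= (trC (A ^+ 2)) -!exprD.
  ring.
clearbody P Q.
rewrite expr2 mulrDl !mulrDr !mxtraceD -!expr2 (trC Q) trPQ trPP.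
lra.
Qed.

(** The matrices [(U + A) / 2] and [(U - A) / 2] are the 0/1 adjacency matrix
    of [G] and its transpose; the walk follows an edge forward and the next
    one backward. *)
Lemma tr_alternating_C4 :
  \tr (((U + A) * (U - A)) ^+ 2) =
    16 * #|homs C4_alternating (edge G)|%:R :> R.
Proof.
pose a (i : nat) (u v : G) : R := und R u v + (-1) ^+ i * sgn R u v.
have aE i u v : a i u v = 2 * (if odd i then edge G v u else edge G u v)%:R.
  rewrite /a -signr_odd; case: (odd i); rewrite ?expr0 ?expr1 ?mul1r ?mulN1r.
    by rewrite -sgn_antisym -und_sgn /und underlying_sym.
  by rewrite und_sgn.
have -> : ((U + A) * (U - A)) ^+ 2 = \prod_(i < 4) mx_of (a i).
  have mE i : mx_of (a i) = U + (-1) ^+ i *: A.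
    by rewrite adjmxE underlying_adjmxE; apply/matrixP => x y; rewrite !mxE.
  rewrite !big_ord_recl big_ord0 !mE /= mulr1 /bump /=.
  by rewrite expr2 !exprS expr0 !mulr1 ?mulrNN ?mulr1 ?scaleN1r ?scale1r ?mulrA.
rewrite (tr_closed_walks a) //.
rewrite -[homs _ _](_ : [set f | f \in homs C4_alternating (edge G)] = _); last first.
  by apply/setP => f; rewrite inE.
rewrite -sum_indicator -sum_tuple_ffun mulr_sumr; apply: eq_bigr => s _.
under eq_bigr do rewrite aE.
rewrite big_split /= prodr_const card_ord -natrX; congr (_ * _).
rewrite -natr_forall; congr (_%:R); congr nat_of_bool.
apply/forallP/homsP => [H i j|H i].
  rewrite !ffunE /C4_alternating => /and3P[/orP[] /eqP -> i0 j1].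
    by have := H i; rewrite (negbTE i0).
  by have := H j; rewrite j1.
have := H i (ordS i); have := H (ordS i) i.
rewrite !ffunE /C4_alternating /Cycle !eqxx orbT /= odd_ordS4 negbK.
by case: (odd i) => [/(_ isT)|_ /(_ isT)].
Qed.

(** Applying the Cauchy-Schwarz inequality twice bounds the bilinear form of
    the skew-symmetric matrix [A] at two indicator vectors. *)
Lemma tau_pow4_le : (tau G)%:~R ^+ 4 <= n ^+ 4 * \tr (A ^+ 4).
Proof.
have [B [C tE]] := tau_attained G.
pose x : 'cV[R]_#|G| := \col_i (enum_val i \in B)%:R.
pose y : 'cV[R]_#|G| := \col_i (enum_val i \in C)%:R.
have frob_ind (D : {set G}) :
    frob2 (\col_(i < #|G|) (enum_val i \in D)%:R : 'cV[R]__) <= n.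
  rewrite /frob2 -[X in _ <= X%:R]card_ord -[X in _ <= X]mulr1 mulr_natl -sumr_const.
  apply: ler_sum => i _; rewrite big_ord1 mxE.
  by case: (_ \in _); rewrite ?expr1n ?expr0n.
have tauE : (tau G)%:~R = (x^T *m A *m y) 0 0.
  have sum_ind (D : {set G}) (F : G -> R) :
      \sum_(u in D) F u = \sum_(i < #|G|) (enum_val i \in D)%:R * F (enum_val i).
    rewrite big_mkcond (reindex (@enum_val G G)) /=; last exact/onW_bij/enum_val_bij.
    by apply: eq_bigr => i _; case: ifP; rewrite ?mul1r ?mul0r.
  rewrite tE net_edgesE sum_ind mxE.
  under [RHS]eq_bigr do rewrite mxE mulr_suml.
  rewrite exchange_big /=; apply: eq_bigr => i _; rewrite sum_ind mulr_sumr.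
  by apply: eq_bigr => j _; rewrite adjmxE !mxE -mulrA [_ * sgn _ _ _]mulrC.
have q4 : (tau G)%:~R ^+ 4 <= (frob2 x) ^+ 2 * frob2 (A *m y) ^+ 2.
  rewrite -[4%N]/(2 * 2)%N exprM tauE -frob2_scalar -exprMn.
  rewrite lerXn2r ?nnegrE ?mulr_ge0 ?frob2_ge0 //.
  by rewrite -mulmxA -(frob2_tr x) frob2_mul.
have Ay : frob2 (A *m y) ^+ 2 <= frob2 y ^+ 2 * \tr (A ^+ 4).
  have -> : frob2 (A *m y) = (y^T *m (A^T *m A *m y)) 0 0.
    by rewrite -frob2_tr -tr_mul_trmx trmxK trmx_mul mulmxA trace_mx11 !mulmxA.
  rewrite -frob2_scalar expr2 -mulrA -{1}(frob2_tr y).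
  apply: le_trans (frob2_mul _ _) _; rewrite ler_wpM2l ?frob2_ge0 //.
  apply: le_trans (frob2_mul _ _) _.
  by rewrite trmx_adjmx mulNmx frob2N mulmxE -expr2 frob2_adjmx_sqr mulrC.
apply: (le_trans q4).
have tr0 : 0 <= \tr (A ^+ 4) by rewrite -frob2_adjmx_sqr frob2_ge0.
apply: (@le_trans _ _ (n ^+ 2 * (n ^+ 2 * \tr (A ^+ 4)))); last by rewrite mulrA -exprD.
apply: ler_pM; rewrite ?exprn_ge0 ?frob2_ge0 //.
  by rewrite lerXn2r ?nnegrE ?frob2_ge0 ?ler0n ?frob_ind.
apply: (le_trans Ay); rewrite ler_wpM2r //.
by rewrite lerXn2r ?nnegrE ?frob2_ge0 ?ler0n ?frob_ind.
Qed.

(** The trace is read as the inner product of [A ^ 2] and the transpose of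
    [A ^ k.+1]. *)
Lemma tr_adjmx_le k :
  \tr (A ^+ k.+3) ^+ 2 <= n ^+ (2 * k.+1) * \tr (A ^+ 4).
Proof.
rewrite -[k.+3]/(2 + k.+1)%N exprD -mulmxE mulrC -frob2_adjmx_sqr.
apply: le_trans (tr_mul_le _ _) _; rewrite ler_wpM2l ?frob2_ge0 //.
apply: le_trans (frob2_exp _ _) _.
by rewrite exprM lerXn2r ?nnegrE ?frob2_ge0 ?exprn_ge0 // frob2_adjmx.
Qed.

End FourthMoment.

(** * Eigenvalues *)

Section NormalMatrices.
Variables (C : numClosedFieldType) (n : nat).
Implicit Types N : 'M[C]_n.
Local Open Scope sesquilinear_scope.

Lemma tr_mul_adjoint N : \tr (N *m N ^t*) = \sum_i \sum_j `|N i j| ^+ 2.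
Proof.
apply: eq_bigr => i _; rewrite mxE; apply: eq_bigr => j _.
by rewrite !mxE normCK.
Qed.

(** In an orthonormal basis of eigenvectors, both sides are sums over the
    eigenvalues, with exponents four and two. *)
Lemma normal_tr4_le N (rho : C) : N \is normalmx ->
    (forall a, eigenvalue N a -> `|a| <= rho) ->
  `|\tr (N ^+ 4)| <= rho ^+ 2 * \sum_i \sum_j `|N i j| ^+ 2.
Proof.
move=> /orthomx_spectralP NE rhoP.
move: (spectral_unitarymx N) NE.
set P := spectralmx N; set d := spectral_diag N => Pu NE.
have PU : P \in unitmx by apply: unitarymx_unit.
have d_eig i : eigenvalue N (d 0 i).
  apply/eigenvalueP; exists (row i P).
    rewrite -row_mul {1}NE -!mulmxA mulKVmx //.
    by apply/rowP => j; rewrite mul_diag_mx !mxE.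
  apply/negP => /eqP r0; have := mulmxV PU => /matrixP/(_ i i).
  rewrite -[LHS](_ : (row i P *m invmx P) 0 i = _); last by rewrite -row_mul mxE.
  by rewrite r0 mul0mx !mxE eqxx => /esym/eqP; rewrite oner_eq0.
have N2 e : (invmx P *m diag_mx e *m P) ^+ 2 =
    invmx P *m diag_mx (\row_j e 0 j ^+ 2) *m P.
  have -> : \row_j e 0 j ^+ 2 = \row_j (e 0 j * e 0 j).
    by apply/rowP => j; rewrite !mxE expr2.
  by rewrite -mulmx_diag expr2 -!mulmxE !mulmxA mulmxK.
have trD e : \tr (invmx P *m diag_mx e *m P) = \sum_i e 0 i.
  by rewrite mxtrace_mulC mulmxA mulmxV // mul1mx mxtrace_diag.
have -> : \tr (N ^+ 4) = \sum_i d 0 i ^+ 4.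
  rewrite -[4%N]/(2 * 2)%N exprM NE !N2 trD; apply: eq_bigr => i _.
  by rewrite !mxE -exprM.
have -> : \sum_i \sum_j `|N i j| ^+ 2 = \sum_i `|d 0 i| ^+ 2.
  rewrite -tr_mul_adjoint.
  have -> : N ^t* = invmx P *m diag_mx (\row_j (d 0 j)^*) *m P.
    rewrite {1}NE invmx_unitary // !trmx_mul !map_mxM trmxCK mulmxA.
    congr (_ *m _ *m _); apply/matrixP => i j; rewrite !mxE eq_sym.
    by case: eqP => [->|_]; rewrite /= ?mulr1n ?mulr0n ?rmorph0.
  rewrite NE !mulmxA mulmxK // -[_ *m diag_mx d *m _]mulmxA mulmx_diag trD.
  by apply: eq_bigr => i _; rewrite !mxE normCK.
apply: le_trans (ler_norm_sum _ _ _) _; rewrite mulr_sumr.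
apply: ler_sum => i _; rewrite normrX -[4%N]/(2 + 2)%N exprD.
rewrite ler_wpM2r ?exprn_ge0 // lerXn2r ?nnegrE //; last exact: rhoP.
by apply: le_trans (rhoP _ (d_eig i)).
Qed.

End NormalMatrices.


Section LargestEigenvalue.
Variable R : realType.
Local Notation C := R[i].
Local Open Scope sesquilinear_scope.

Lemma normr_normc (z : C) : `|z| = (Normc.normc z)%:C%C.
Proof. by []. Qed.

Lemma normc_ge0 (z : C) : 0 <= Normc.normc z.
Proof. by rewrite -ler0c -normr_normc. Qed.

(** The eigenvalues are the finitely many roots of the characteristic
    polynomial, so one of largest modulus exists. *)
Lemma lambda1P n (A : 'M[C]_n) : (0 < n)%N -> largest_eigenvalue A (lambda1 A).
Proof.
move=> n0; rewrite /lambda1; case: xgetP => [l _ //|no].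
have [a0 a0A] := eigenvalue_closed A n0.
have [rs E] := closed_field_poly_normal (char_poly A).
have rsP a : (a \in rs) = eigenvalue A a.
  rewrite eigenvalue_root_char E rootZ ?root_prod_XsubC //.
  by rewrite (monicP (char_poly_monic A)) oner_eq0.
pose F (i : 'I_(size rs)) := Normc.normc rs`_i.
have i0P : (index a0 rs < size rs)%N by rewrite index_mem rsP.
case: (@Order.TotalTheory.arg_maxP _ _ _ (Ordinal i0P) xpredT F erefl) => i _ imax.
case: (no rs`_i); split; first by rewrite -rsP mem_nth.
move=> b; rewrite -rsP => brs.
have bP : (index b rs < size rs)%N by rewrite index_mem.
by have := imax (Ordinal bP) erefl; rewrite /F /= nth_index.
Qed.

(** The Cauchy-Schwarz inequality for [v *m A = a *: v]. *)
Lemma eigenvalue_le_frobenius n (A : 'M[C]_n) a : eigenvalue A a ->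
  Normc.normc a ^+ 2 <= \sum_i \sum_j Normc.normc (A i j) ^+ 2.
Proof.
move=> /eigenvalueP[v vA v0].
pose w i := Normc.normc (v 0 i).
have w_ge0 i : 0 <= w i := normc_ge0 _.
have wa j : (Normc.normc a * w j) ^+ 2 <=
    (\sum_i w i ^+ 2) * \sum_i Normc.normc (A i j) ^+ 2.
  apply: le_trans (cauchy_schwarz _ _).
  rewrite lerXn2r ?nnegrE ?mulr_ge0 ?normc_ge0 //.
    by apply: sumr_ge0 => i _; rewrite mulr_ge0 ?normc_ge0.
  rewrite -lecR -Normc.normcM -normr_normc.
  have <- : (v *m A) 0 j = a * v 0 j by rewrite vA mxE.
  rewrite mxE rmorph_sum /=; apply: le_trans (ler_norm_sum _ _ _) _.
  by apply: ler_sum => i _; rewrite normr_normc Normc.normcM.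
have V0 : 0 < \sum_i w i ^+ 2.
  have [i vi] : exists i, v 0 i != 0.
    apply/existsP; apply: contraNT v0 => /existsPn H; apply/eqP/rowP => i.
    by rewrite mxE; apply/eqP/negPn.
  rewrite (bigD1 i) //= ltr_pwDl ?sumr_ge0 // => [|j _]; last exact: sqr_ge0.
  rewrite exprn_gt0 // lt_def w_ge0 andbT.
  by apply: contra vi => /eqP /Normc.eq0_normc ->.
rewrite -(ler_pM2r V0) [X in _ <= X]mulrC mulr_sumr.
rewrite exchange_big /= mulr_sumr; apply: ler_sum => j _.
by rewrite -exprMn.
Qed.

Section Graph.
Variable G : digraph.
Local Notation n := (#|G|%:R : R).

Lemma adjmx_complex : adjmx C G = map_mx (real_complex R) (adjmx R G).
Proof.
apply/matrixP => i j; rewrite !mxE.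
by do 2?case: ifP => _; rewrite ?rmorphN ?rmorph1 ?rmorph0.
Qed.

Lemma underlying_adjmx_complex :
  underlying_adjmx C G = map_mx (real_complex R) (underlying_adjmx R G).
Proof. by apply/matrixP => i j; rewrite !mxE rmorph_nat. Qed.

Lemma normc_real (x : R) : Normc.normc (real_complex R x) = `|x|.
Proof. by rewrite /Normc.normc /= expr0n addr0 sqrtr_sqr. Qed.

Lemma map_real_exp m (M : 'M[R]_m) k :
  map_mx (real_complex R) M ^+ k = map_mx (real_complex R) (M ^+ k).
Proof.
elim: k => [|k IH]; first by rewrite !expr0 map_mx1.
by rewrite !exprS IH -!mulmxE map_mxM.
Qed.

Lemma eigenvalue_real_le m (M : 'M[R]_m) a :
  eigenvalue (map_mx (real_complex R) M) a -> Normc.normc a ^+ 2 <= frob2 M.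
Proof.
move=> /eigenvalue_le_frobenius/le_trans; apply.
rewrite le_eqVlt; apply/orP; left; apply/eqP; apply: eq_bigr => i _.
by apply: eq_bigr => j _; rewrite mxE normc_real real_normK ?num_real.
Qed.

(** The square of [a] is an eigenvalue of [A ^ 2], whose squared Frobenius norm
    is the fourth moment of [A]. *)
Lemma eigenvalue_adjmx_le a : eigenvalue (adjmx C G) a ->
  Normc.normc a ^+ 4 <= \tr (adjmx R G ^+ 4).
Proof.
rewrite adjmx_complex => /eigenvalueP[v vA v0].
rewrite -frob2_adjmx_sqr -[4%N]/(2 * 2)%N exprM.
have -> : Normc.normc a ^+ 2 = Normc.normc (a ^+ 2) by rewrite !expr2 Normc.normcM.
apply: eigenvalue_real_le; apply/eigenvalueP; exists v => //.
rewrite -map_real_exp !expr2 -mulmxE mulmxA vA -scalemxAl vA scalerA.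
by [].
Qed.

Lemma frob2_underlying_adjmx : frob2 (underlying_adjmx R G) <= n ^+ 2.
Proof.
rewrite expr2 -natrM; apply: (@le_trans _ _ (\sum_(i < #|G|) \sum_(j < #|G|) 1)).
  apply: ler_sum => i _; apply: ler_sum => j _; rewrite mxE.
  by case: (underlying _ _); rewrite ?expr1n ?expr0n.
by rewrite !sumr_const card_ord -mulrnA.
Qed.

Lemma eigenvalue_underlying_adjmx_le a : eigenvalue (underlying_adjmx C G) a ->
  Normc.normc a <= n.
Proof.
rewrite underlying_adjmx_complex => /eigenvalue_real_le a2.
have na := normc_ge0 a.
rewrite -(@ler_pXn2r _ 2) ?nnegrE ?ler0n //.
exact: le_trans a2 frob2_underlying_adjmx.
Qed.

(** Symmetric and skew-symmetric real matrices are normal.  The bound on the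
    Frobenius norm holds for both adjacency matrices, whose entries are at
    most one in modulus. *)
Lemma tr_pow4_le_lambda1 (M : 'M[R]_#|G|) : (0 < #|G|)%N ->
    M^T = M \/ M^T = - M -> frob2 M <= n ^+ 2 ->
  `|\tr (M ^+ 4)| <=
    Normc.normc (lambda1 (map_mx (real_complex R) M)) ^+ 2 * n ^+ 2.
Proof.
move=> n0 tM fM; set N := map_mx _ M; set l := lambda1 N.
have [_ l_max] := lambda1P N n0.
have Nn : N \is normalmx.
  apply/normalmxP.
  have -> : N ^t* = map_mx (real_complex R) M^T.
    apply/matrixP => i j; rewrite !mxE; exact: conjc_real.
  by rewrite -!map_mxM; case: tM => ->; rewrite ?mulmxN ?mulNmx.
have := normal_tr4_le Nn (rho := `|l|).
have -> : \sum_i \sum_j `|N i j| ^+ 2 = real_complex R (frob2 M).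
  rewrite rmorph_sum; apply: eq_bigr => i _; rewrite rmorph_sum.
  apply: eq_bigr => j _; rewrite mxE normr_normc normc_real.
  by rewrite -rmorphXn real_normK ?num_real.
rewrite map_real_exp trace_map_mx !normr_normc normc_real.
rewrite -(rmorphXn (real_complex R)) -rmorphM lecR => H.
apply: (le_trans (H _)); last by rewrite ler_wpM2l ?exprn_ge0 ?normc_ge0.
by move=> a aN; rewrite normr_normc lecR; apply: l_max.
Qed.

End Graph.

End LargestEigenvalue.

(** * Asymptotics along a dense sequence *)

Local Open Scope classical_set_scope.

Section LittleO.
Variable R : realType.
Implicit Types f g h : nat -> R.

Lemma littleoP f g : is_littleo f g <->
  forall e, 0 < e -> \forall i \near \oo, `|f i| <= e * `|g i|.
Proof. by rewrite /is_littleo; exact: (@eqoP R nat R^o R^o). Qed.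

(** Two functions of the same order of magnitude define the same little-o. *)
Lemma littleo_order f g h (K : R) : 0 < K ->
    (\forall i \near \oo, `|g i| <= K * `|h i|) ->
  is_littleo f g -> is_littleo f h.
Proof.
move=> K0 gh /littleoP fg; apply/littleoP => e e0.
have := fg (e / K) (divr_gt0 e0 K0); apply: filterS2 gh => i gh /le_trans; apply.
apply: (le_trans (ler_wpM2l _ gh)); first by rewrite divr_ge0 ?ltW.
by rewrite mulrA divfK ?gt_eqF.
Qed.

End LittleO.

Section DenseSequence.
Variables (R : realType) (c : R) (G : nat -> digraph).
Hypothesis c0 : 0 < c.
Hypothesis G_infty : #|G i| @[i --> \oo] --> \oo.
Hypothesis dense : forall i, c * #|G i|%:R ^+ 2 <= #|edges (G i)|%:R.

Local Notation n i := (#|G i|%:R : R).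
Local Notation m i := (#|edges (G i)|%:R : R).

Definition negligible (k : nat) (f : nat -> R) : Prop :=
  is_littleo f (fun i => n i ^+ k).

Lemma negligibleP k f : negligible k f <->
  forall e, 0 < e -> \forall i \near \oo, `|f i| <= e * n i ^+ k.
Proof.
have nE i : `|n i ^+ k| = n i ^+ k by rewrite ger0_norm ?exprn_ge0.
by rewrite /negligible littleoP; split => H e /H; apply: filterS => i; rewrite nE.
Qed.

Lemma large_order (N : nat) : \forall i \near \oo, (N <= #|G i|)%N.
Proof. by move/cvgnyPge: G_infty => /(_ N). Qed.

Lemma large_order_real (x : R) : \forall i \near \oo, x <= n i.
Proof.
have := large_order (Num.truncn x).+1; apply: filterS => i H.
apply: (@le_trans _ _ (Num.truncn x).+1%:R); last by rewrite ler_nat.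
exact/ltW/truncnS_gt.
Qed.

(** The form in which inequalities valid for each graph become implications
    between asymptotic statements. *)
Lemma negligible_transfer a b (f h : nat -> R) :
    (forall e, 0 < e -> exists2 d, 0 < d & \forall i \near \oo,
      `|f i| <= d * n i ^+ a -> `|h i| <= e * n i ^+ b) ->
  negligible a f -> negligible b h.
Proof.
move=> fh /negligibleP Hf; apply/negligibleP => e /fh[d /Hf + ].
by apply: filterS2 => i fi; apply.
Qed.

(** The special case where [h] is bounded by a multiple of [f]. *)
Lemma negligible_le k (f h : nat -> R) (K : R) : 0 < K ->
    (\forall i \near \oo, `|h i| <= K * `|f i|) ->
  negligible k f -> negligible k h.
Proof.
move=> K0 fh; apply: negligible_transfer => e e0; exists (e / K).
  exact: divr_gt0.
apply: filterS fh => i fh H; apply: (le_trans fh).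
by rewrite -ler_pdivlMl // mulrA [K^-1 * e]mulrC.
Qed.

Lemma negligibleD k f h : negligible k f -> negligible k h ->
  negligible k (fun i => f i + h i).
Proof.
move=> /negligibleP Hf /negligibleP Hh; apply/negligibleP => e e0.
have e2 : 0 < e / 2 by rewrite divr_gt0.
apply: filterS2 (Hf _ e2) (Hh _ e2) => i fi hi.
apply: le_trans (ler_normD _ _) _; apply: (le_trans (lerD fi hi)).
by rewrite -mulrDl -splitr.
Qed.

(** An error with a saving of a full factor [n] is negligible. *)
Lemma negligible_saving k (f : nat -> R) (K : R) :
    (forall i, `|f i| * n i <= K * n i ^+ k) -> negligible k f.
Proof.
move=> H; apply/negligibleP => e e0.
apply: filterS2 (large_order_real (K / e)) (large_order 1) => i Kn n1.
have n0 : 0 < n i by rewrite ltr0n.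
rewrite -(ler_pM2r n0); apply: (le_trans (H i)); rewrite mulrAC.
by rewrite ler_wpM2r ?exprn_ge0 // mulrC -ler_pdivrMr.
Qed.

Lemma edges_le i : m i <= n i ^+ 2.
Proof.
rewrite expr2 -natrM ler_nat; apply: leq_trans (max_card _) _.
by rewrite card_prod.
Qed.

Lemma littleo_edges f : is_littleo f (fun i => m i) <-> negligible 2 f.
Proof.
split.
  apply: (littleo_order (K := 1)) => //; apply: nearW => i.
  by rewrite mul1r !ger0_norm ?exprn_ge0 // edges_le.
apply: (littleo_order (K := c^-1)); first by rewrite invr_gt0.
apply: nearW => i; rewrite !ger0_norm ?exprn_ge0 //.
by rewrite ler_pdivlMl.
Qed.

(** When the reference function has the exact order [n ^ k], an asymptotic
    ratio is an additive statement. *)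
Lemma asymp_ratioP (a : R) (k : nat) (kappa K : R) (f g : nat -> R) :
    0 < kappa -> 0 < K ->
    (\forall i \near \oo, kappa * n i ^+ k <= g i <= K * n i ^+ k) ->
  asymp_ratio a f g <-> negligible k (fun i => f i - a * g i).
Proof.
move=> k0 K0 gP; split.
  move=> [u [/cvgr0Pnorm_le u0 fE]]; apply/negligibleP => e e0.
  have := u0 _ (divr_gt0 e0 K0) => uK.
  near=> i.
  have -> : f i = (a + u i) * g i by near: i.
  have /andP[g1 g2] : kappa * n i ^+ k <= g i <= K * n i ^+ k by near: i.
  have g_ge0 : 0 <= g i by apply: le_trans g1; rewrite mulr_ge0 ?exprn_ge0 // ltW.
  rewrite mulrDl addrAC subrr add0r normrM [`|g i|]ger0_norm //.
  apply: (@le_trans _ _ (e / K * (K * n i ^+ k))).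
    by apply: ler_pM => //; near: i.
  by rewrite mulrA divfK ?gt_eqF.
move=> /negligibleP H; exists (fun i => (f i - a * g i) / g i).
have npos : \forall i \near \oo, 0 < n i.
  by apply: filterS (large_order 1) => i; rewrite ltr0n.
split; last first.
  near=> i.
  have ni : 0 < n i by near: i.
  have /andP[g1 _] : kappa * n i ^+ k <= g i <= K * n i ^+ k by near: i.
  have g_gt0 : 0 < g i by apply: lt_le_trans g1; rewrite mulr_gt0 ?exprn_gt0.
  by rewrite mulrDl divfK ?gt_eqF // addrC subrK.
apply/cvgr0Pnorm_le => e e0.
have := H _ (mulr_gt0 e0 k0) => He.
near=> i.
have ni : 0 < n i by near: i.
have /andP[g1 _] : kappa * n i ^+ k <= g i <= K * n i ^+ k by near: i.
have g_gt0 : 0 < g i by apply: lt_le_trans g1; rewrite mulr_gt0 ?exprn_gt0.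
rewrite normrM normfV [`|g i|]gtr0_norm // ler_pdivrMr //.
have : `|f i - a * g i| <= e * kappa * n i ^+ k by near: i.
by move=> /le_trans; apply; rewrite -mulrA ler_wpM2l // ltW.
Unshelve. all: by end_near.
Qed.


(** * Implications between the properties *)

Local Notation tauR i := ((tau (G i))%:~R : R).
Local Notation T4 := (fun i => \tr (adjmx R (G i) ^+ 4)).

Lemma tauR_ge0 i : 0 <= tauR i. Proof. by rewrite ler0z tau_ge0. Qed.

Lemma negligible_tau_star : negligible 2 (fun i => tauR i) ->
  negligible 2 (fun i => (tau_star (G i))%:~R).
Proof.
apply: (negligible_le (K := 1)) => //; apply: nearW => i.
rewrite mul1r !ger0_norm ?ler0z ?tau_star_ge0 ?tau_ge0 //.
by rewrite ler_int tau_star_le_tau.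
Qed.

Lemma negligible_tau_of_star :
  negligible 2 (fun i => (tau_star (G i))%:~R) -> negligible 2 (fun i => tauR i).
Proof.
apply: (negligible_le (K := 3)) => //; apply: nearW => i.
rewrite !ger0_norm ?ler0z ?tau_star_ge0 ?tau_ge0 //.
by rewrite -[3]/(3%:~R) -intrM ler_int (tau_le_tau_star R).
Qed.

Lemma half_minus_beta_ge0 (H : digraph) : 0 <= half_minus_beta R H.
Proof.
have := tau_star_le_feedback R H; have := tau_star_ge0 H.
by rewrite -(ler0z R); lra.
Qed.

Lemma negligible_star_of_feedback : negligible 2 (fun i => half_minus_beta R (G i)) ->
  negligible 2 (fun i => (tau_star (G i))%:~R).
Proof.
apply: (negligible_le (K := 2)) => //; apply: nearW => i.
rewrite !ger0_norm ?ler0z ?tau_star_ge0 ?half_minus_beta_ge0 //.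
exact: tau_star_le_feedback.
Qed.

Lemma negligible_feedback : negligible 2 (fun i => tauR i) ->
  negligible 2 (fun i => half_minus_beta R (G i)).
Proof.
apply: negligible_transfer => e e0.
(* The bound q + 1 on the number of intervals depends on e only: edges inside them
   account for about n ^ 2 / q, and rectangles for (q + 1) tau. *)
pose q := (Num.truncn (2 / e)).+1.
have q0 : 0 < q%:R :> R by rewrite ltr0n.
have qe : q%:R^-1 <= e / 2 :> R.
  rewrite -[e / 2]invrK lef_pV2 ?posrE ?invr_gt0 ?divr_gt0 //.
  rewrite invf_div; exact/ltW/truncnS_gt.
exists (e / (2 * (q.+1)%:R)); first by rewrite divr_gt0 // mulr_gt0.
apply: filterS (large_order_real (2 / e)) => i ni.
rewrite !ger0_norm ?tauR_ge0 ?half_minus_beta_ge0 // => tau_i.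
pose L := (#|G i| %/ q).+1.
have := feedback_le_tau R (G i) (ltn0Sn (#|G i| %/ q)).
rewrite -/L => /le_trans le_.
have L_le : (L%:R : R) <= n i / q%:R + 1.
  rewrite /L -natr1 lerD2r ler_pdivlMr // -natrM ler_nat; exact: leq_trunc_div.
have q_le : ((#|G i| %/ L).+1 <= q.+1)%N.
  rewrite ltnS -ltnS ltn_divLR // mulnC.
  apply: leq_trans (ltn_ceil #|G i| (ltn0Sn _ : 0 < q)%N) _.
  by rewrite leq_mul2l leqnSn orbT.
suff : 2 * half_minus_beta R (G i) <= 2 * (e * n i ^+ 2) by rewrite ler_pM2l.
apply: le_; apply: (@le_trans _ _ (n i * (n i / q%:R + 1) +
    (q.+1)%:R * (e / (2 * (q.+1)%:R) * n i ^+ 2))).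
  apply: lerD; first by rewrite ler_wpM2l.
  by apply: ler_pM; rewrite ?tauR_ge0 // ler_nat.
have -> : (q.+1)%:R * (e / (2 * (q.+1)%:R) * n i ^+ 2) = e / 2 * n i ^+ 2.
  have : (q.+1)%:R != 0 :> R by rewrite pnatr_eq0.
  by move: (q.+1)%:R => z z0; field.
have n1 : n i <= e / 2 * n i ^+ 2.
  rewrite expr2 mulrA -[X in X <= _]mul1r ler_wpM2r // mulrC -ler_pdivrMr ?divr_gt0 //.
  by rewrite mul1r invf_div.
have n2 : n i * (n i / q%:R) <= e / 2 * n i ^+ 2.
  rewrite mulrA -expr2 [X in _ <= X]mulrC.
  by rewrite ler_wpM2l ?exprn_ge0.
have p0 : 0 <= e * n i ^+ 2 by rewrite mulr_ge0 ?exprn_ge0 // ltW.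
rewrite mulrDr mulr1.
lra.
Qed.

Lemma negligible_tau_of_T4 : negligible 4 T4 -> negligible 2 (fun i => tauR i).
Proof.
apply: negligible_transfer => e e0; exists (e ^+ 4); first exact: exprn_gt0.
apply: nearW => i Hi; rewrite ger0_norm ?tauR_ge0 //.
rewrite -(@ler_pXn2r _ 4) ?nnegrE ?tauR_ge0 ?mulr_ge0 ?exprn_ge0 ?(ltW e0) //.
apply: le_trans (tau_pow4_le R (G i)) _.
apply: (le_trans (ler_wpM2l _ (le_trans (ler_norm _) Hi))); first exact: exprn_ge0.
by rewrite exprMn -exprM mulrCA -exprD.
Qed.

Lemma orientation_negligible (B : digraph) : negligible 2 (fun i => tauR i) ->
  negligible #|B| (fun i =>
    (labeled_copies (edge B) (edge (G i)))%:R -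
    2 ^- #|edges B| * (labeled_copies (@underlying B) (@underlying (G i)))%:R).
Proof.
apply: negligible_transfer => e e0; exists e => //.
apply: filterS (large_order 1) => i n1; rewrite ger0_norm ?tauR_ge0 // => tau_i.
have ni : 0 < n i ^+ 2 by rewrite exprn_gt0 // ltr0n.
have p0 : 0 < 2 ^+ #|edges B| :> R by rewrite exprn_gt0.
rewrite -(ler_pM2r ni) -(ler_pM2l p0) mulrA.
rewrite -{1}[2 ^+ #|edges B|]ger0_norm ?(ltW p0) // -normrM mulrBr mulVKf ?gt_eqF //.
apply: le_trans (orientation_count R B (G i)) _.
by rewrite ler_pM2l // mulrAC ler_wpM2r ?exprn_ge0.
Qed.

Lemma negligible_noninjective (S : finType) :
  negligible #|S| (fun i =>
    #|[set f : {ffun S -> G i} | ~~ injectiveb f]%SET|%:R).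
Proof.
apply: (negligible_saving (K := #|S|%:R ^+ 2)) => i.
rewrite ger0_norm // -natrM -!natrX -natrM ler_nat; exact: card_noninjective.
Qed.

Lemma underlying_dense i :
  c * n i ^+ 2 <= \sum_(u : G i) \sum_(v : G i) (underlying u v)%:R.
Proof.
apply: (le_trans (dense i)); rewrite card_edges natr_sum; apply: ler_sum => u _.
rewrite natr_sum; apply: ler_sum => v _; rewrite ler_nat /underlying.
by case: (edge _ u v).
Qed.

Lemma homs_lower (S : finType) (r : rel S) (side : S -> bool) :
    (forall x y, r x y -> side x != side y) ->
  \forall i \near \oo,
    c ^+ (#|S| * #|S|) * n i ^+ #|S| <= #|homs r (@underlying (G i))|%:R.
Proof.
move=> sideP; apply: filterS (large_order 1) => i n1.
apply: bipartite_homs sideP n1; first exact: ltW.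
  exact: underlying_sym.
exact: underlying_dense.
Qed.

Lemma labeled_copies_upper (S : finType) (r : rel S) i :
  (labeled_copies r (@underlying (G i)))%:R <= n i ^+ #|S|.
Proof. by rewrite -natrX ler_nat -card_ffun; apply: max_card. Qed.

(** Non-injective homomorphisms are too few to affect the order of
    magnitude. *)
Lemma labeled_copies_order (S : finType) (r : rel S) (side : S -> bool) :
    (forall x y, r x y -> side x != side y) ->
  \forall i \near \oo, c ^+ (#|S| * #|S|) / 2 * n i ^+ #|S| <=
    (labeled_copies r (@underlying (G i)))%:R <= 1 * n i ^+ #|S|.
Proof.
move=> sideP; have kappa0 : 0 < c ^+ (#|S| * #|S|) / 2.
  by rewrite divr_gt0 ?exprn_gt0.
have /negligibleP/(_ _ kappa0) := negligible_noninjective S.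
apply: filterS2 (homs_lower sideP) => i lower noninj.
rewrite mul1r labeled_copies_upper andbT.
have := card_embeddings r (@underlying (G i)).
rewrite -(ler_nat R) natrD; move: noninj; rewrite ger0_norm //.
move: lower; set x := c ^+ _; set y := n i ^+ _.
have -> : x / 2 * y = x * y / 2 by rewrite mulrAC.
set z := x * y.
lra.
Qed.

Lemma asymp_ratio_bipartite (a : R) (S : finType) (r : rel S) (side : S -> bool) f :
    (forall x y, r x y -> side x != side y) ->
  asymp_ratio a f (fun i => (labeled_copies r (@underlying (G i)))%:R) <->
  negligible #|S|
    (fun i => f i - a * (labeled_copies r (@underlying (G i)))%:R).
Proof.
move=> sideP; apply: asymp_ratioP (labeled_copies_order sideP) => //.
by rewrite divr_gt0 ?exprn_gt0.
Qed.


Lemma C4_alternating_loopless (i : 'I_4) : ~~ C4_alternating i i.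
Proof. by rewrite /C4_alternating; case: (odd i); rewrite ?andbF. Qed.

Lemma C4_alternating_oriented (i j : 'I_4) :
  C4_alternating i j -> ~~ C4_alternating j i.
Proof. by case/and3P => _ /negbTE i0 _; rewrite /C4_alternating i0 !andbF. Qed.

Definition C4_digraph : digraph :=
  Digraph C4_alternating_loopless C4_alternating_oriented.

Lemma card_edges_C4 : #|edges C4_digraph| = 4.
Proof. by rewrite card_edges !big_ord_recl !big_ord0. Qed.

Lemma Cycle_bipartite (k : nat) (i j : 'I_k) : ~~ odd k -> Cycle i j ->
  odd i != odd j.
Proof.
move=> ek.
have oS (x : 'I_k) : odd (ordS x) = ~~ odd x by rewrite /= odd_mod // (negbTE ek).
by case/orP => /eqP ->; rewrite oS; case: (odd _).
Qed.

Lemma C4_ratio_of_bipartite :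
    asymp_ratio (2 ^- #|edges C4_digraph| : R)
      (fun i => (labeled_copies (edge C4_digraph) (edge (G i)))%:R)
      (fun i => (labeled_copies (@underlying C4_digraph) (@underlying (G i)))%:R) ->
  asymp_ratio (1 / 8 : R)
    (fun i => (copies C4_alternating (edge (G i)))%:R)
    (fun i => (copies (@Cycle 4) (@underlying (G i)))%:R).
Proof.
rewrite card_edges_C4 => -[u [u0 uE]]; exists (fun i => 2 * u i); split.
  by rewrite -(mulr0 2); apply: cvgM => //; apply: cvg_cst.
apply: filterS uE => i.
have [a a0 [-> E]] := copies_C4 (edge (G i)) (@underlying (G i)).
have -> : labeled_copies (@underlying C4_digraph) (@underlying (G i)) =
    labeled_copies (@Cycle 4) (@underlying (G i)).
  apply: eq_card => f; rewrite !inE; congr (_ && _).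
  apply: eq_forallb => x; apply: eq_forallb => y.
  by rewrite -C4_underlying.
rewrite E !natrM => uE.
have a_neq0 : a%:R != 0 :> R by rewrite pnatr_eq0 -lt0n.
apply: (mulfI a_neq0); rewrite uE.
by field.
Qed.

(** By [alternating_C4_ge] the number of alternating 4-cycles exceeds the
    random proportion by a multiple of the fourth moment, up to the
    non-injective closed walks. *)
Lemma negligible_T4_of_C4 :
    asymp_ratio (1 / 8 : R)
      (fun i => (copies C4_alternating (edge (G i)))%:R)
      (fun i => (copies (@Cycle 4) (@underlying (G i)))%:R) ->
  negligible 4 T4.
Proof.
move=> [u [/cvgr0Pnorm_le u0 uE]]; apply/negligibleP => e e0.
have /negligibleP noninj := negligible_noninjective 'I_4.
rewrite card_ord in noninj.
have e1 : 0 < e / 16 by rewrite divr_gt0.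
have e2 : 0 < e / 32 by rewrite divr_gt0.
have := u0 _ e1 => u1; have := noninj _ e2 => nin.
near=> i.
have fE : (copies C4_alternating (edge (G i)))%:R =
  (1 / 8 + u i) * (copies (@Cycle 4) (@underlying (G i)))%:R by near: i.
have ui : `|u i| <= e / 16 by near: i.
have : `|(#|[set f : {ffun 'I_4 -> G i} | ~~ injectiveb f]%SET|%:R : R)| <=
  e / 32 * n i ^+ 4 by near: i.
rewrite ger0_norm // => Ni.
have [a a0 [alt cyc]] := copies_C4 (edge (G i)) (@underlying (G i)).
have trA0 : 0 <= T4 i by rewrite -frob2_adjmx_sqr frob2_ge0.
rewrite ger0_norm //.
have := alternating_C4_ge R (G i); rewrite tr_alternating_C4 tr_homs_cycle //.
have := card_embeddings C4_alternating (edge (G i)).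
have := embeddings_sub_homs (@Cycle 4) (@underlying (G i)).
have := labeled_copies_upper (@Cycle 4) i; rewrite card_ord.
rewrite -!(ler_nat R) natrD.
have altE : (labeled_copies C4_alternating (edge (G i)))%:R =
  (1 / 16 + u i / 2) * (labeled_copies (@Cycle 4) (@underlying (G i)))%:R :> R.
  by rewrite alt cyc !natrM fE; field.
rewrite altE.
set N := (labeled_copies (@Cycle 4) _)%:R; set y := n i ^+ 4.
have N0 : 0 <= N by rewrite ler0n.
set z := #|[set _ | _]%SET|%:R in Ni *.
move=> N_le H1 H2 H3.
have uN : u i * N <= e / 16 * y.
  apply: le_trans (ler_wpM2r N0 (le_trans (ler_norm _) ui)) _.
  by rewrite ler_wpM2l // ltW.
move: H1 H2 H3 uN Ni; rewrite /T4 -/y.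
rewrite mulrDl [u i / 2 * N]mulrAC.
move: (u i * N) => w.
lra.
Unshelve. all: by end_near.
Qed.

Lemma tr_underlying_order (k : nat) : ~~ odd k -> (0 < k)%N ->
  \forall i \near \oo,
    c ^+ (k * k) * n i ^+ k <= \tr (underlying_adjmx R (G i) ^+ k) <= n i ^+ k.
Proof.
move=> ek k0; have := homs_lower (fun i j : 'I_k => @Cycle_bipartite k i j ek).
apply: filterS => i; rewrite card_ord tr_homs_cycle // => -> /=.
by rewrite -natrX ler_nat; apply: leq_trans (max_card _) _; rewrite card_ffun card_ord.
Qed.

Lemma trace_littleo (k : nat) : ~~ odd k -> (0 < k)%N ->
  is_littleo (fun i => \tr (adjmx R (G i) ^+ k))
             (fun i => \tr (underlying_adjmx R (G i) ^+ k)) <->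
  negligible k (fun i => \tr (adjmx R (G i) ^+ k)).
Proof.
move=> ek k0; have order := tr_underlying_order ek k0.
have ck : 0 < c ^+ (k * k) by rewrite exprn_gt0.
split.
  apply: (littleo_order (K := 1)) => //; apply: filterS order => i /andP[l1 l2].
  rewrite mul1r !ger0_norm ?exprn_ge0 //.
  by apply: le_trans l1; rewrite mulr_ge0 ?exprn_ge0 // ltW.
apply: (littleo_order (K := (c ^+ (k * k))^-1)); first by rewrite invr_gt0.
apply: filterS order => i /andP[l1 l2].
rewrite [`|n i ^+ k|]ger0_norm ?exprn_ge0 // ler_pdivlMl // (le_trans l1) //.
exact: ler_norm.
Qed.

(** By the two trace formulas, the deviation of the number of even-switch
    cycles from half the number of cycles is half the trace of [A ^ k], up to
    closed walks with repeated vertices. *)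
Lemma even_switch_ratio (k : nat) : ~~ odd k -> (0 < k)%N ->
  asymp_ratio (1 / 2 : R)
    (fun i => (even_switch_cycles k (G i))%:R)
    (fun i => (labeled_copies (@Cycle k) (@underlying (G i)))%:R) <->
  negligible k (fun i => \tr (adjmx R (G i) ^+ k)).
Proof.
move=> ek k0.
rewrite (asymp_ratio_bipartite _ _ (fun i j : 'I_k => @Cycle_bipartite k i j ek)).
rewrite card_ord.
pose d i : R := \tr (underlying_adjmx R (G i) ^+ k) -
  (labeled_copies (@Cycle k) (@underlying (G i)))%:R.
have d_negl : negligible k d.
  have := negligible_noninjective 'I_k; rewrite card_ord.
  apply: (negligible_le (K := 1)) => //; apply: nearW => i.
  rewrite mul1r /d tr_homs_cycle //.
  have := card_embeddings (@Cycle k) (@underlying (G i)).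
  have := embeddings_sub_homs (@Cycle k) (@underlying (G i)).
  rewrite -!(ler_nat R) natrD => H1 H2; rewrite !ger0_norm ?subr_ge0 //.
  by rewrite lerBlDl.
have key i : \tr (adjmx R (G i) ^+ k) + d i = 2 * ((even_switch_cycles k (G i))%:R -
    1 / 2 * (labeled_copies (@Cycle k) (@underlying (G i)))%:R).
  by rewrite mulrBr -tr_even_switch // /d; field.
split => H.
  have : negligible k (fun i => \tr (adjmx R (G i) ^+ k) + d i).
    apply: (negligible_le (K := 2)) H => //; apply: nearW => i.
    by rewrite key normrM normr_nat.
  move=> H1.
  have : negligible k (fun i => - d i).
    apply: (negligible_le (K := 1)) d_negl => //; apply: nearW => i.
    by rewrite normrN mul1r.
  move/(negligibleD H1); congr (negligible k _); apply/funext => i.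
  by rewrite addrK.
have := negligibleD H d_negl.
apply: (negligible_le (K := 1)) => //; apply: nearW => i.
by rewrite key normrM normr_nat [X in _ <= X]mul1r ler_peMl ?normr_ge0 ?ler1n.
Qed.

Lemma negligible_traces (k : nat) : (4 <= k)%N -> negligible 4 T4 ->
  negligible k (fun i => \tr (adjmx R (G i) ^+ k)).
Proof.
case: k => [|[|[|k]]] // _; apply: negligible_transfer => e e0.
exists (e ^+ 2); first exact: exprn_gt0.
apply: nearW => i Hi.
have nk : 0 <= n i ^+ k.+3 by apply: exprn_ge0.
have en : 0 <= e * n i ^+ k.+3 by apply: mulr_ge0 nk; apply: ltW.
rewrite -(@ler_pXn2r _ 2) ?nnegrE //.
rewrite real_normK ?num_real //.
apply: le_trans (tr_adjmx_le R (G i) k) _.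
apply: (le_trans (ler_wpM2l _ (le_trans (ler_norm _) Hi))); first exact: exprn_ge0.
rewrite exprMn -exprM mulrCA -exprD.
have -> : (2 * k.+1 + 4 = k.+3 * 2)%N by lia.
exact: lexx.
Qed.


(** The lower bound comes from the many closed 4-walks in a dense graph: there
    are at least [c ^ 16 n ^ 4], and by [tr_pow4_le_lambda1] at most
    [|lambda1| ^ 2 n ^ 2]. *)
Lemma lambda1_underlying_order :
  \forall i \near \oo, c ^+ 8 * n i <=
    Normc.normc (lambda1 (underlying_adjmx R[i] (G i))) <= n i.
Proof.
have order : \forall i \near \oo,
    c ^+ (4 * 4) * n i ^+ 4 <= \tr (underlying_adjmx R (G i) ^+ 4) <= n i ^+ 4.
  exact: tr_underlying_order.
apply: filterS2 (large_order 1) order => i n1 /andP[lower _].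
have ni : 0 < n i by rewrite ltr0n.
have [eig _] := lambda1P (underlying_adjmx R[i] (G i)) n1.
rewrite eigenvalue_underlying_adjmx_le // andbT.
have := @tr_pow4_le_lambda1 R (G i) (underlying_adjmx R (G i)) n1
  (or_introl (trmx_underlying_adjmx R (G i))) (frob2_underlying_adjmx R (G i)).
rewrite -underlying_adjmx_complex => /(le_trans (ler_norm _)) /(le_trans lower).
rewrite -[n i ^+ 4]/(n i ^+ (2 + 2)) exprD mulrA ler_pM2r ?exprn_gt0 // => H.
rewrite -(@ler_pXn2r _ 2) ?nnegrE ?normc_ge0 ?mulr_ge0 ?exprn_ge0 ?(ltW c0) //.
by rewrite exprMn -exprM.
Qed.

Lemma lambda1_littleo :
  is_littleo
    (fun i => Normc.normc (lambda1 (adjmx R[i] (G i))))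
    (fun i => Normc.normc (lambda1 (underlying_adjmx R[i] (G i)))) <->
  negligible 4 T4.
Proof.
have c8 : 0 < c ^+ 8 by rewrite exprn_gt0.
have order : is_littleo
    (fun i => Normc.normc (lambda1 (adjmx R[i] (G i))))
    (fun i => Normc.normc (lambda1 (underlying_adjmx R[i] (G i)))) <->
  negligible 1 (fun i => Normc.normc (lambda1 (adjmx R[i] (G i)))).
  split.
    apply: (littleo_order (K := 1)) => //.
    apply: filterS lambda1_underlying_order => i /andP[_ l].
    by rewrite mul1r expr1 !ger0_norm ?normc_ge0.
  apply: (littleo_order (K := (c ^+ 8)^-1)); first by rewrite invr_gt0.
  apply: filterS lambda1_underlying_order => i /andP[l _].
  by rewrite expr1 !ger0_norm ?normc_ge0 // ler_pdivlMl.
rewrite order; split; apply: negligible_transfer => e e0.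
  exists (Num.sqrt e); first by rewrite sqrtr_gt0.
  apply: filterS (large_order 1) => i n1; rewrite expr1 ger0_norm ?normc_ge0 // => H.
  have := @tr_pow4_le_lambda1 R (G i) (adjmx R (G i)) n1
    (or_intror (trmx_adjmx R (G i))) (frob2_adjmx R (G i)).
  rewrite -adjmx_complex => /le_trans; apply.
  rewrite -[n i ^+ 4]/(n i ^+ (2 + 2)) exprD [X in _ <= X]mulrA ler_wpM2r ?exprn_ge0 //.
  rewrite -[e in _ <= e * _]sqr_sqrtr ?(ltW e0) // -exprMn.
  by rewrite ler_pXn2r ?nnegrE ?normc_ge0 ?mulr_ge0 ?sqrtr_ge0.
exists (e ^+ 4); first exact: exprn_gt0.
apply: filterS (large_order 1) => i n1 H; rewrite expr1 ger0_norm ?normc_ge0 //.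
have [eig _] := lambda1P (adjmx R[i] (G i)) n1.
rewrite -(@ler_pXn2r _ 4) ?nnegrE ?normc_ge0 ?mulr_ge0 ?(ltW e0) //.
rewrite exprMn; apply: le_trans (le_trans (ler_norm _) H).
exact: eigenvalue_adjmx_le.
Qed.

(** Each rectangle counted by the bias has [(1 - delta) e(A, B) <= tau], so it
    suffices that [1 - delta] tends to zero more slowly than [tau / m].  The
    square root of this ratio does; the term [1 / (i + 1)] keeps [1 - delta]
    positive, and the minimum with [1 / 2] keeps [delta] positive. *)
Lemma bias_of_tau : negligible 2 (fun i => tauR i) ->
  exists delta : nat -> R,
    [/\ forall i, 0 < delta i < 1,
        delta i @[i --> \oo] --> (1 : R) &
        is_littleo (fun i => (bias (delta i) (G i))%:R) (fun i => m i)].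
Proof.
move=> /littleo_edges/littleoP tau_o.
pose x i : R := tauR i / m i.
pose d i : R := Num.min (1 / 2) (Num.sqrt (x i) + (i.+1)%:R^-1).
have x_ge0 i : 0 <= x i by rewrite divr_ge0 ?tauR_ge0.
have d_gt0 i : 0 < d i.
  by rewrite lt_min divr_gt0 //= ltr_wpDl ?sqrtr_ge0 ?invr_gt0 ?ltr0n.
have d_le i : d i <= 1 / 2 by rewrite ge_min lexx.
have m_gt0 : \forall i \near \oo, 0 < m i.
  apply: filterS (large_order 1) => i n1; apply: lt_le_trans (dense i).
  by rewrite mulr_gt0 ?exprn_gt0 ?ltr0n.
have x_small e : 0 < e -> \forall i \near \oo, Num.sqrt (x i) <= e.
  move=> e0; have := tau_o (e ^+ 2) (exprn_gt0 2 e0).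
  apply: filterS2 m_gt0 => i mi; rewrite !ger0_norm ?tauR_ge0 // => H.
  rewrite -(@ler_pXn2r _ 2) ?nnegrE ?sqrtr_ge0 ?(ltW e0) // sqr_sqrtr //.
  by rewrite ler_pdivrMr.
exists (fun i => 1 - d i); split.
- move=> i /=; have := d_gt0 i; have := d_le i; move: (d i) => y y1 y0.
  rewrite subr_gt0 gtrBl y0 andbT (le_lt_trans y1) //.
  by rewrite ltr_pdivrMr // mul1r ltr1n.
- rewrite -[X in _ --> X]subr0; apply: cvgB; first exact: cvg_cst.
  apply/cvgr0Pnorm_le => e e0; have e2 : 0 < e / 2 by rewrite divr_gt0.
  have := x_small _ e2; have : \forall i \near \oo, (i.+1)%:R^-1 <= e / 2 :> R.
    apply: filterS (nbhs_infty_ge (Num.truncn (2 / e))) => i /= ti.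
    rewrite -[e / 2]invrK lef_pV2 ?posrE ?invr_gt0 // invf_div.
    by apply/ltW/(lt_le_trans (truncnS_gt _)); rewrite ler_nat ltnS.
  apply: filterS2 => i Hi Hx; rewrite ger0_norm ?(ltW (d_gt0 _)) //.
  by rewrite ge_min; apply/orP; right; rewrite (splitr e) lerD.
apply/littleoP => e e0.
have e2 : 0 < e / 2 by rewrite divr_gt0.
have := tau_o _ e2; have := x_small _ e0.
apply: filterS3 m_gt0 => i mi xi; rewrite !ger0_norm ?tauR_ge0 // => ti.
have := bias_le_tau (G i) (1 - d i); rewrite subKr.
set b : R := (bias _ _)%:R => bd.
have b0 : 0 <= b by rewrite ler0n.
have dE : d i = 1 / 2 \/ Num.sqrt (x i) <= d i.
  rewrite /d /Num.min; case: ifP => _; [by left|right].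
  by rewrite lerDl invr_ge0.
case: dE => [dE|dx].
  by move: bd; rewrite dE; lra.
have tE : tauR i = Num.sqrt (x i) * (Num.sqrt (x i) * m i).
  by rewrite mulrA -expr2 sqr_sqrtr // /x divfK // gt_eqF.
apply: (@le_trans _ _ (Num.sqrt (x i) * m i)); last by rewrite ler_wpM2r.
have [s0|s0] := eqVneq (Num.sqrt (x i)) 0.
  by move: bd; rewrite tE s0 !mul0r pmulr_lle0.
have spos : 0 < Num.sqrt (x i) by rewrite lt_def s0 sqrtr_ge0.
rewrite -(ler_pM2l spos) -tE mulrC; apply: le_trans bd.
by rewrite ler_wpM2l.
Qed.

Lemma tau_of_bias (delta : nat -> R) :
    (forall i, 0 < delta i < 1) -> delta i @[i --> \oo] --> (1 : R) ->
    is_littleo (fun i => (bias (delta i) (G i))%:R) (fun i => m i) ->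
  negligible 2 (fun i => tauR i).
Proof.
move=> d01 /cvgrPdist_le d1 /littleoP bias_o; apply/littleo_edges/littleoP => e e0.
have e2 : 0 < e / 2 by rewrite divr_gt0.
apply: filterS2 (d1 _ e2) (bias_o _ e2) => i.
have /andP[d0 dlt] := d01 i.
rewrite ger0_norm ?subr_ge0 ?(ltW dlt) // => di.
rewrite !ger0_norm ?tauR_ge0 // => bi.
have := @tau_le_bias R (G i) (delta i); rewrite (ltW d0) (ltW dlt) => /(_ isT).
move=> /le_trans; apply.
have := ler_wpM2r (ler0n R #|edges (G i)|) di.
lra.
Qed.

Lemma bipartite_ratio (B : digraph) : bipartite B ->
    negligible 2 (fun i => tauR i) ->
  asymp_ratio (2 ^- #|edges B| : R)
    (fun i => (labeled_copies (edge B) (edge (G i)))%:R)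
    (fun i => (labeled_copies (@underlying B) (@underlying (G i)))%:R).
Proof.
move=> [side sideP] tau_o; apply/(asymp_ratio_bipartite _ _ sideP).
exact: orientation_negligible.
Qed.

Lemma bipartite_C4 : bipartite C4_digraph.
Proof.
exists (fun i : 'I_4 => odd i) => i j.
by rewrite /underlying /= C4_underlying; apply: Cycle_bipartite.
Qed.

End DenseSequence.


Theorem theorem6p4 (R : realType) (c : R) (G : nat -> digraph) :
  0 < c ->
  #|G i| @[i --> \oo] --> \oo ->
  (forall i, c * #|G i|%:R ^+ 2 <= #|edges (G i)|%:R) ->
  let m : nat -> R := fun i => #|edges (G i)|%:R in
  [<-> is_littleo (fun i => (tau (G i))%:~R) m;
       is_littleo (fun i => (tau_star (G i))%:~R) m;
       is_littleo (fun i => half_minus_beta R (G i)) m;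
       asymp_ratio (1 / 8 : R)
         (fun i => (copies C4_alternating (edge (G i)))%:R)
         (fun i => (copies (@Cycle 4) (@underlying (G i)))%:R);
       forall B : digraph, bipartite B ->
         asymp_ratio (2 ^- #|edges B| : R)
           (fun i => (labeled_copies (edge B) (edge (G i)))%:R)
           (fun i => (labeled_copies (@underlying B) (@underlying (G i)))%:R);
       forall k : nat, (4 <= k)%N -> ~~ odd k ->
         asymp_ratio (1 / 2 : R)
           (fun i => (even_switch_cycles k (G i))%:R)
           (fun i => (labeled_copies (@Cycle k) (@underlying (G i)))%:R);
       forall k : nat, (4 <= k)%N -> ~~ odd k ->
         is_littleo (fun i => \tr (adjmx R (G i) ^+ k))
                    (fun i => \tr (underlying_adjmx R (G i) ^+ k));
       is_littleo
         (fun i => Normc.normc (lambda1 (adjmx R[i] (G i))))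
         (fun i => Normc.normc (lambda1 (underlying_adjmx R[i] (G i))));
       exists delta : nat -> R,
         [/\ forall i, 0 < delta i < 1,
             delta i @[i --> \oo] --> (1 : R) &
             is_littleo (fun i => (bias (delta i) (G i))%:R) m]].
Proof.
move=> c0 G_infty dense m.
have edgesE f := littleo_edges c0 dense f.
have T4_tau := @negligible_tau_of_T4 R G.
have C4_T4 := @negligible_T4_of_C4 R G G_infty.
have bip := bipartite_ratio c0 G_infty dense.
have eig := lambda1_littleo c0 G_infty dense.
have pos k : (4 <= k)%N -> (0 < k)%N by apply: leq_trans.
tfae.
- by move=> /edgesE H; apply/edgesE; apply: negligible_tau_star.
- move=> /edgesE/negligible_tau_of_star H; apply/edgesE.
  exact: negligible_feedback.
- move=> /edgesE/negligible_star_of_feedback/negligible_tau_of_star H.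
  exact: C4_ratio_of_bipartite (bip _ bipartite_C4 H).
- by move=> /C4_T4/T4_tau H B B_bip; apply: bip.
- move=> /(_ _ bipartite_C4)/C4_ratio_of_bipartite/C4_T4 H k k4 ek.
  apply/(even_switch_ratio c0 G_infty dense ek (pos k k4)).
  exact: negligible_traces.
- move=> H k k4 ek; apply/(trace_littleo c0 G_infty dense ek (pos k k4)).
  by apply/(even_switch_ratio c0 G_infty dense ek (pos k k4)); apply: H.
- move=> /(_ 4%N isT isT)/(@trace_littleo _ _ _ c0 G_infty dense 4 isT isT) H.
  exact/eig.
- by move=> /eig/T4_tau; apply: (bias_of_tau c0 G_infty dense).
- move=> [delta [d01 d1 b_o]]; apply/edgesE.
  exact: (tau_of_bias c0 dense d01 d1 b_o).
Qed.
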